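(* There exists a measure $\mu\in\mathcal{M}_0\cap\mathcal{M}_1$ such that $$\int_\Omega L\,d\mu=\inf_{\nu\in\mathcal{M}_0\cap\mathcal{M}_1}\int_\Omega L\,d\nu .$$
   Context: Fix $\sigma\ge 0$. Let $\mathbb{T}^n=\mathbb{R}^n/\mathbb{Z}^n$ and $\Omega=\mathbb{T}^n\times\mathbb{R}^n$, with points $(x,v)$. The Lagrangian $L(x,v)$ is smooth in both variables, $\mathbb{Z}^n$-periodic in $x$, coercive and strictly convex in $v$, and $L\ge 0$. Fix a function $\gamma=\gamma(|v|):\Omega\to[1,+\infty)$ with $L(x,v)/\gamma(v)\to+\infty$ and $|v|/\gamma(v)\to 0$ as $|v|\to+\infty$. $C^0_\gamma(\Omega)$ is the space of continuous functions $\phi$ on $\Omega$ with $\|\phi\|_\gamma=\sup_\Omega|\phi/\gamma|<\infty$ and $\phi(x,v)/\gamma(v)\to 0$ as $|v|\to\infty$. $\mathcal{M}$ is the set of signed Radon measures $\mu$ on $\Omega$ with $\int_\Omega\gamma\,d|\mu|<\infty$; it is regarded (via integration) as the dual of $C^0_\gamma(\Omega)$. Controlled diffusion: $dx=v\,dt+\sigma\,dw$, where $w$ is an $n$-dimensional Brownian motion, $v$ is a progressively measurable control and the process starts at some initial point. For each bounded control strategy $v$ and $T>0$ define $\mu_T$ by $\int\phi\,d\mu_T=\frac1T E\int_0^T\phi(x(t),v(t))\,dt$ for $\phi\in C^0_\gamma(\Omega)$, with $x(t)$ taken modulo $\mathbb{Z}^n$. A measure $\mu(v)$ is any weak-$*$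 limit of $\mu_T$ along a sequence $T\to+\infty$. $\mathcal{M}_0$ is the weak-$*$ closure of the set of all measures $\mu(v)$, $v$ a bounded control strategy. $\mathcal{M}_1=\{\mu\in\mathcal{M}:\mu\ge 0,\ \int_\Omega d\mu=1\}$.
   Formalization: The weight γ is assumed continuous in |v|; for an arbitrary function γ≥1 (e.g. one with a non-integrable singularity at some v0) the infimum need not be attained. *)

(* Defs.v *)
From HB Require Import structures.
From mathcomp Require Import all_boot all_order all_algebra generic_quotient.
From mathcomp Require Import all_classical all_reals all_analysis.

Set Implicit Arguments.
Unset Strict Implicit.
Unset Printing Implicit Defensive.

Import Order.TTheory GRing.Theory Num.Theory.
Import numFieldNormedType.Exports.

Local Open Scope classical_set_scope.
Local Open Scope ring_scope.
Local Open Scope quotient_scope.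

(* The canonical norm of ['rV[R]_n] is the sup norm, whereas [|v|] in
   [gamma (|v|)] is the Euclidean one. *)
Definition enorm (R : realType) (n : nat) (v : 'rV[R]_n) : R :=
  Num.sqrt (\sum_(i < n) v 0 i ^+ 2).

Section torus.
Context (R : realType) (n : nat).

Definition int_translate (x y : 'rV[R]_n) : bool :=
  [forall i, (x 0 i - y 0 i) \is a Num.int].

Lemma int_translate_refl : reflexive int_translate.
Proof. by move=> x; apply/forallP => i; rewrite subrr. Qed.

Lemma int_translate_sym : symmetric int_translate.
Proof. by move=> x y; apply: eq_forallb => i; rewrite -rpredN opprB. Qed.

Lemma int_translate_trans : transitive int_translate.
Proof.
move=> y x z /forallP xy /forallP yz; apply/forallP => i.
by rewrite -(subrKA (y 0 i)) rpredD.
Qed.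

Definition int_translate_equiv :=
  EquivRel int_translate int_translate_refl int_translate_sym
    int_translate_trans.

Definition torus := {eq_quot int_translate_equiv}.
HB.instance Definition _ := Quotient.on torus.
HB.instance Definition _ := Topological.copy torus (quotient_topology torus).
HB.instance Definition _ := isPointed.Build torus (\pi_torus 0).

Definition to_torus (x : 'rV[R]_n) : torus := \pi_torus x.

End torus.

Notation Omega R n := (torus R n * 'rV[R]_n)%type.

(* [Omega] with its Borel sigma-algebra.  As [Omega] is locally compact and
   second countable, its finite signed Radon measures are exactly the charges
   on this measurable space. *)
Notation borelOmega R n := (g_sigma_algebraType (@open (Omega R n))).

Section signed_measures.
Context d (T : measurableType d) (R : realType).
Variable mu : {charge set T -> \bar R}.
Local Open Scope ereal_scope.

Definition hahn_pos : set T := projT1 (cid (Hahn_decomposition mu)).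

Definition hahn_neg : set T :=
  projT1 (cid (projT2 (cid (Hahn_decomposition mu)))).

Definition hahn_posneg : hahn_decomposition mu hahn_pos hahn_neg :=
  projT2 (cid (projT2 (cid (Hahn_decomposition mu)))).

(* [|mu|] *)
Definition total_variation : set T -> \bar R := charge_variation hahn_posneg.

Definition charge_integral (f : T -> R) : \bar R :=
  \int[jordan_pos hahn_posneg]_z (f z)%:E -
  \int[jordan_neg hahn_posneg]_z (f z)%:E.

End signed_measures.

Section weighted_spaces.
Context (R : realType) (n : nat).

(* [g] is the radial profile of the weight: [gamma (x, v) = g (|v|)]. *)
Variable g : R -> R.

Definition weight (z : Omega R n) : R := g (enorm z.2).

Definition in_C0gamma (phi : Omega R n -> R) : Prop :=
  [/\ continuous phi,
      exists C : R, forall z, `|phi z / weight z| <= C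
    & forall e : R, 0 < e ->
        exists r : R, forall z, r < enorm z.2 -> `|phi z / weight z| < e].

Record C0gamma : Type := C0Gamma {
  C0gamma_fun :> Omega R n -> R;
  C0gammaP : in_C0gamma C0gamma_fun }.

Definition in_Mgamma (mu : {charge set (borelOmega R n) -> \bar R}) : Prop :=
  (\int[total_variation mu]_z (weight z)%:E < +oo)%E.

Record Mgamma : Type := MGamma {
  Mgamma_charge :> {charge set (borelOmega R n) -> \bar R};
  MgammaP : in_Mgamma Mgamma_charge }.

Definition pairing (mu : Mgamma) : {ptws C0gamma -> R} :=
  fun phi => fine (charge_integral mu phi).

(* The weak-* topology: the coarsest one making all the maps
   [mu |-> \int phi dmu] with [phi] in [C0gamma] continuous. *)
HB.instance Definition _ := gen_eqMixin Mgamma.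
HB.instance Definition _ := gen_choiceMixin Mgamma.
HB.instance Definition _ :=
  Topological.copy Mgamma (initial_topology pairing).

Definition M1 : set Mgamma :=
  [set mu : Mgamma |
    (forall A, measurable A -> (0 <= mu A)%E) /\ mu setT = 1%E].

End weighted_spaces.

Arguments M1 {R} n g.

Section controlled_diffusion.
Context (R : realType) (n : nat) (sigma : R).
Context d (W : measurableType d) (P : probability W R).

Definition filtration (F : R -> set_system W) : Prop :=
  [/\ forall t, 0 <= t -> sigma_algebra setT (F t),
      forall t, 0 <= t -> F t `<=` measurable
    & forall s t, 0 <= s -> s <= t -> F s `<=` F t].

(* [w] is an [n]-dimensional Brownian motion for the filtration [F]; the last
   clause says that [w t - w s] is independent of [F s] with law
   [N(0, (t - s) Id)]. *)
Definition brownian_motion (F : R -> set_system W)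
    (w : R -> W -> 'rV[R]_n) : Prop :=
  [/\ {ae P, forall om, w 0 om = 0},
      forall om, {within `[0, +oo[, continuous (w ^~ om)},
      forall t i, 0 <= t ->
        measurable_fun setT
          ((fun om => w t om 0 i) : g_sigma_algebraType (F t) -> R)
    & forall s t (A : set W) (B : 'I_n -> set R), 0 <= s -> s < t -> F s A ->
        (forall i, measurable (B i)) ->
        P (A `&` [set om | forall i, B i ((w t om - w s om) 0 i)]) =
        (P A *
         \prod_(i < n) normal_prob 0 (Num.sqrt (t - s)) (B i))%E].

Definition progressively_measurable (F : R -> set_system W)
    (v : R -> W -> 'rV[R]_n) : Prop :=
  forall t i, 0 <= t ->
    measurable_fun
      (`[0, t] `*` setT : set (measurableTypeR R * g_sigma_algebraType (F t)))
      (fun p => v p.1 p.2 0 i).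

Definition bounded_control (F : R -> set_system W)
    (v : R -> W -> 'rV[R]_n) : Prop :=
  progressively_measurable F v /\
  exists C : R, forall t om, 0 <= t -> enorm (v t om) <= C.

(* The solution of [dx = v dt + sigma dw], [x 0 = x0], lifted to R^n. *)
Definition trajectory (w v : R -> W -> 'rV[R]_n) (x0 : 'rV[R]_n) (t : R)
    (om : W) : 'rV[R]_n :=
  \row_i (x0 0 i +
          (\int[lebesgue_measure]_(s in `[0, t]) v s om 0 i)%R +
          sigma * w t om 0 i).

Variable g : R -> R.

(* Testing against [C0gamma] determines [mu] on Borel sets, hence up to the
   irrelevant values of a charge on non-measurable sets. *)
Definition occupation_measure (w v : R -> W -> 'rV[R]_n) (x0 : 'rV[R]_n)
    (T : R) (mu : Mgamma n g) : Prop :=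
  forall phi : C0gamma n g,
    charge_integral mu phi =
    (T^-1%:E * \int[P]_om \int[lebesgue_measure]_(t in `[0%R, T])
       (phi (to_torus (trajectory w v x0 t om), v t om))%:E)%E.

Definition limit_measure (w v : R -> W -> 'rV[R]_n) (x0 : 'rV[R]_n)
    (mu : Mgamma n g) : Prop :=
  exists (T : R^nat) (muT : nat -> Mgamma n g),
    [/\ forall k, 0 < T k, T @ \oo --> +oo,
        forall k, occupation_measure w v x0 (T k) (muT k)
      & muT @ \oo --> mu].

Definition M0 (F : R -> set_system W) (w : R -> W -> 'rV[R]_n) :
    set (Mgamma n g) :=
  closure [set mu : Mgamma n g | exists v x0, bounded_control F v /\
                                 limit_measure w v x0 mu].

End controlled_diffusion.

Arguments M0 {R n} sigma {d W} P g F w.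

Section lagrangian.
Context (R : realType) (n : nat).

(* Derivatives of all orders in all directions exist and are Frechet
   differentiable, i.e. [f] is of class C^oo. *)
Definition smooth (V : normedModType R) (f : V -> R) : Prop :=
  forall (us : seq V) (p : V),
    differentiable (foldr (fun u h => 'D_u h) f us) p.

Record lagrangian (L : 'rV[R]_n -> 'rV[R]_n -> R) : Prop := Lagrangian {
  lagrangian_smooth : smooth (fun p : 'rV[R]_n * 'rV[R]_n => L p.1 p.2);
  lagrangian_periodic : forall x y v, int_translate x y -> L x v = L y v;
  lagrangian_coercive :
    forall A : R, exists r : R, forall x v, r < enorm v -> A < L x v;
  lagrangian_strictly_convex : forall x v1 v2 (t : R),
    v1 != v2 -> 0 < t < 1 ->
    L x (t *: v1 + (1 - t) *: v2) < t * L x v1 + (1 - t) * L x v2;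
  lagrangian_ge0 : forall x v, 0 <= L x v }.

(* Continuity of the profile is what makes integration identify [Mgamma] with
   the dual of [C0gamma]; limits as [|v|] tends to infinity are uniform
   in [x]. *)
Record admissible_weight (L : 'rV[R]_n -> 'rV[R]_n -> R) (g : R -> R) : Prop :=
  AdmissibleWeight {
  weight_continuous : {within `[0, +oo[, continuous g};
  weight_ge1 : forall s, 0 <= s -> 1 <= g s;
  weight_lagrangian : forall A : R, exists r : R, forall x v,
    r < enorm v -> A < L x v / g (enorm v);
  weight_superlinear : forall e : R, 0 < e ->
    exists r : R, forall v : 'rV[R]_n,
      r < enorm v -> enorm v / g (enorm v) < e }.

(* The function induced on [Omega] by a [Z^n]-periodic [L]. *)
Definition on_Omega (L : 'rV[R]_n -> 'rV[R]_n -> R) (z : Omega R n) : R :=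
  L (repr z.1) z.2.

Definition action (L : 'rV[R]_n -> 'rV[R]_n -> R) (g : R -> R)
    (mu : Mgamma n g) : \bar R :=
  charge_integral mu (on_Omega L).

End lagrangian.

Arguments action {R n} L g mu.

(* Main.v *)
(** A minimizing sequence has bounded action.  Since [L] is coercive the
    sequence is tight, and since [gamma = o(L)] its limit along an ultrafilter
    integrates every function of [C0gamma] correctly; the limit is a measure by
    the Riesz representation theorem, and the action is lower semicontinuous
    as a supremum of the continuous functionals [mu |-> \int min(L, k) dmu].

    The admissible set is not empty: the control [v = 0] yields measures [mu_T]
    carried by the compact set [torus x {0}], which have a limit along an
    ultrafilter of times [T] tending to infinity.  This limit is attained along
    a genuine sequence [T_k], because the integrals of all continuous functions
    are controlled by the masses of the countably many cells of the grids of
    mesh [1/k]. *)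
Require Import Defs.
From HB Require Import structures.
From mathcomp Require Import all_boot all_order all_algebra generic_quotient.
From mathcomp Require Import all_classical all_reals all_analysis.
From mathcomp Require Import measurable_realfun ring lra.

Set Implicit Arguments.
Unset Strict Implicit.
Unset Printing Implicit Defensive.

Import Order.TTheory GRing.Theory Num.Theory.
Import numFieldNormedType.Exports.

Local Open Scope classical_set_scope.
Local Open Scope ring_scope.

(** Along an ultrafilter every bounded real quantity converges, so the limits of all integrals exist
    at once and metrizability of the weak-* topology never enters. Such a limit is good enough for
    membership in [M0], which is closed by definition, but not for [limit_measure], which demands a
    sequence of times; only the nonemptiness proof has to pay for that. All limits are taken on
    bounded continuous functions. As [Omega] is not compact, a positive functional on them may lose
    mass at infinity, and tightness excludes this by fixing the total mass of the representing
    measure. Unbounded integrands are reached by truncation: [min(H, k)] increases to [H], while a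
    function of [C0gamma] differs from its clamped version by at most [e * gamma], and the integrals
    of [gamma] are bounded by a constant plus the action. *)

Definition bounded_continuous (R : realType) (T : topologicalType)
  (f : T -> R) : Prop := continuous f /\ exists M, forall x, `|f x| <= M.

Section bounded_continuous_lemmas.
Context (R : realType) (T : topologicalType).
Implicit Types f g : T -> R.

Lemma bounded_continuous_cst (c : R) : bounded_continuous (fun _ : T => c).
Proof. by split; [exact: cst_continuous|exists `|c|]. Qed.

Lemma bounded_continuousD f g : bounded_continuous f -> bounded_continuous g ->
  bounded_continuous (f \+ g).
Proof.
move=> [cf [M fM]] [cg [N gN]]; split.
  by move=> x; apply: continuousD; [exact: cf|exact: cg].
by exists (M + N) => x; rewrite (le_trans (ler_normD _ _))// lerD.
Qed.

Lemma bounded_continuousM f g : bounded_continuous f -> bounded_continuous g ->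
  bounded_continuous (f \* g).
Proof.
move=> [cf [M fM]] [cg [N gN]]; split.
  by move=> x; apply: continuousM; [exact: cf|exact: cg].
by exists (M * N) => x /=; rewrite normrM ler_pM.
Qed.

Lemma bounded_continuousZ (c : R) f : bounded_continuous f ->
  bounded_continuous (fun x => c * f x).
Proof. exact/bounded_continuousM/bounded_continuous_cst. Qed.

Lemma bounded_continuousB f g : bounded_continuous f -> bounded_continuous g ->
  bounded_continuous (f \- g).
Proof.
move=> bf /(bounded_continuousZ (-1)) bg.
have -> : f \- g = f \+ (fun x => -1 * g x).
  by apply/funext => x /=; rewrite mulN1r.
exact: bounded_continuousD.
Qed.

Lemma bounded_continuous_min f (m : R) :
  continuous f -> (forall x, 0 <= f x) ->
  bounded_continuous (fun x => Num.min (f x) m).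
Proof.
move=> cf f0; split.
  move=> x; apply: (@continuous_min _ _ f (fun=> m)).
    exact: cf.
  exact: cst_continuous.
exists `|m| => x; case: (leP (f x) m) => // fm.
by rewrite ger0_norm// (le_trans fm)// ler_norm.
Qed.

Lemma bounded_continuous_sum (F : nat -> T -> R) n :
  (forall i, bounded_continuous (F i)) ->
  bounded_continuous (fun x => \sum_(i < n) F i x).
Proof.
move=> bF; elim: n => [|n ih].
  under eq_fun do rewrite big_ord0; exact: bounded_continuous_cst.
under eq_fun do rewrite big_ord_recr.
exact: bounded_continuousD.
Qed.

End bounded_continuous_lemmas.

(** Both sides are the unordered sum over all pairs. This flattens a sequence of covers into a
    single cover. *)
Lemma nneseries_pair (R : realType) (a : nat -> nat -> \bar R)
    (h : {bij [set: nat] >-> [set: nat * nat]}) :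
  (forall i j, (0 <= a i j)%E) ->
  (\sum_(i <oo) \sum_(j <oo) a i j = \sum_(k <oo) a (h k).1 (h k).2)%E.
Proof.
move=> a0; rewrite [RHS]nneseries_esumT//.
rewrite -(@reindex_esum _ _ _ setT setT h (fun p => a p.1 p.2)); last first.
  exact: bij.
transitivity (\esum_(p in [set: nat] `*`` (fun=> [set: nat])) a p.1 p.2)%E.
  rewrite -esum_esum//.
  rewrite nneseries_esumT; last by move=> n; exact: nneseries_ge0.
  by apply: eq_esum => i _; rewrite nneseries_esumT.
by congr esum; apply/seteqP; split.
Qed.

Lemma continuous_borel_measurable (R : realType) (T : ptopologicalType)
    (f : T -> R) : continuous f ->
  measurable_fun [set: g_sigma_algebraType (@open T)]
    (f : g_sigma_algebraType (@open T) -> R).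
Proof.
move=> /continuousP cf; apply: (measurability _ (RGenOpens.measurableE R)).
move=> _ [_ [a [b ->] <-]]; rewrite setTI; apply: sub_sigma_algebra.
exact/cf/interval_open.
Qed.

(** * Riesz representation *)

Section daniell.
Context (R : realType) (T : ptopologicalType) (I : (T -> R) -> R).
Hypothesis ID : forall f g, bounded_continuous f -> bounded_continuous g ->
  I (f \+ g) = I f + I g.
Hypothesis IZ : forall c f, bounded_continuous f ->
  I (fun x => c * f x) = c * I f.
Hypothesis I_ge0 : forall f, bounded_continuous f -> (forall x, 0 <= f x) ->
  0 <= I f.

Lemma daniell_functional0 : I (fun=> 0) = 0.
Proof.
have := IZ 0 (bounded_continuous_cst T 0).
by under eq_fun do rewrite mul0r; rewrite mul0r.
Qed.

Lemma daniell_functionalB f g : bounded_continuous f -> bounded_continuous g ->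
  I (f \- g) = I f - I g.
Proof.
move=> bf bg; apply/eqP; rewrite eq_sym subr_eq -ID//; last first.
  exact: bounded_continuousB.
by apply/eqP; congr I; apply/funext => x /=; rewrite subrK.
Qed.

Lemma daniell_functional_le f g : bounded_continuous f ->
  bounded_continuous g -> (forall x, f x <= g x) -> I f <= I g.
Proof.
move=> bf bg fg; rewrite -subr_ge0 -daniell_functionalB//.
by apply: I_ge0; [exact: bounded_continuousB|move=> x /=; rewrite subr_ge0].
Qed.

Lemma daniell_functional_sum (F : nat -> T -> R) n :
  (forall i, bounded_continuous (F i)) ->
  I (fun x => \sum_(i < n) F i x) = \sum_(i < n) I (F i).
Proof.
move=> bF; elim: n => [|n ih].
  by under eq_fun do rewrite big_ord0; rewrite big_ord0 daniell_functional0.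
under eq_fun do rewrite big_ord_recr.
by rewrite big_ord_recr/= -ih -ID//; exact: bounded_continuous_sum.
Qed.

(** Functions replace open sets in the usual coverings: the cost of a cover is then read off [I]
    directly, with no prior content on open sets. *)
Definition daniell_cover (A : set T) (f : nat -> T -> R) : Prop :=
  [/\ forall k, bounded_continuous (f k), forall k x, 0 <= f k x
    & forall x, A x -> (1 <= \sum_(k <oo) (f k x)%:E)%E].

Definition daniell_outer (A : set T) : \bar R :=
  ereal_inf [set \sum_(k <oo) (I (f k))%:E | f in daniell_cover A]%E.

Lemma daniell_outer_le (A : set T) (f : nat -> nat -> T -> R) :
  (forall i j, bounded_continuous (f i j)) -> (forall i j x, 0 <= f i j x) ->
  (forall x, A x -> (1 <= \sum_(i <oo) \sum_(j <oo) (f i j x)%:E)%E) ->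
  (daniell_outer A <= \sum_(i <oo) \sum_(j <oo) (I (f i j))%:E)%E.
Proof.
move=> bf f0 Af; have /card_esym/ppcard_eqP[h] := card_nat2.
rewrite (nneseries_pair h); last by move=> i j; rewrite lee_fin I_ge0.
apply: ereal_inf_lbound; exists (fun k => f (h k).1 (h k).2) => //.
split=> // x /Af; rewrite (nneseries_pair h)//.
by move=> i j; rewrite lee_fin.
Qed.

Lemma daniell_outer_ge0 A : (0 <= daniell_outer A)%E.
Proof.
apply: le_ereal_inf_tmp => _ [f [bf f0 _] <-].
by apply: nneseries_ge0 => k _ _; rewrite lee_fin I_ge0.
Qed.

Lemma daniell_outer_homo :
  {homo daniell_outer : A B / A `<=` B >-> (A <= B)%E}.
Proof.
move=> A B AB; apply: ereal_inf_le_tmp => _ [f [bf f0 fB] <-].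
by exists f => //; split => // x /AB /fB.
Qed.

Lemma daniell_outer0 : daniell_outer set0 = 0%E.
Proof.
apply/eqP; rewrite eq_le daniell_outer_ge0 andbT.
apply: ereal_inf_lbound; exists (fun _ _ => 0).
  by split => // k; exact: bounded_continuous_cst.
by rewrite daniell_functional0 eseries0.
Qed.

(** One function, padded with zeros, is a cover. *)
Lemma daniell_outer1 A f : bounded_continuous f -> (forall x, 0 <= f x) ->
  (forall x, A x -> 1 <= f x) -> (daniell_outer A <= (I f)%:E)%E.
Proof.
move=> bf f0 fA.
have seriesE (a : nat -> R) : (forall k, a k.+1 = 0) -> 0 <= a 0%N ->
    (\sum_(k <oo) (a k)%:E = (a 0)%:E)%E.
  move=> a0 a00; rewrite nneseries_recl//; last by case=> // k _; rewrite a0.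
  by rewrite eseries_cond eseries0 ?adde0// => -[|k]//; rewrite a0.
pose F k := if k is 0%N then f else fun=> 0.
rewrite -(seriesE (I \o F)); last 2 first.
- by move=> k /=; rewrite daniell_functional0.
- by rewrite /= I_ge0.
apply: ereal_inf_lbound; exists F => //; split.
- by case => //= _; exact: bounded_continuous_cst.
- by case => /=.
- by move=> x Ax; rewrite seriesE//= lee_fin fA.
Qed.

(** Covers of the [A n] that are optimal up to [e / 2 ^ n.+1] together cover the union: at a point
    of [A n] the [n]-th cover alone already sums to at least 1. *)
Lemma daniell_outer_sigma_subadditive : sigma_subadditive daniell_outer.
Proof.
move=> A; have [[i ioo]|] := pselect (exists i, daniell_outer (A i) = +oo%E).
  rewrite (eseries_pinfty _ _ ioo) ?leey// => n _.
  by rewrite -ltNye (lt_le_trans _ (daniell_outer_ge0 _)).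
rewrite -forallNE => Aoo; apply/lee_addgt0Pr => e e0.
apply: le_trans (epsilon_trick _ _ _); last 2 first.
- by move=> n; exact: daniell_outer_ge0.
- exact: ltW.
pose P n (f : nat -> T -> R) := daniell_cover (A n) f /\
  (\sum_(k <oo) (I (f k))%:E <= daniell_outer (A n) + (e / (2 ^ n.+1)%:R)%:E)%E.
have [f Pf] : {f : nat -> nat -> T -> R & forall n, P n (f n)}.
  apply: choice => n.
  have fn : daniell_outer (A n) \is a fin_num.
    rewrite ge0_fin_numE ?daniell_outer_ge0// lt_neqAle leey andbT.
    exact/eqP/Aoo.
  have en : 0 < e / (2 ^ n.+1)%:R :> R by rewrite divr_gt0// ltr0n expn_gt0.
  by have [_ [f cf <-] /ltW ?] := lb_ereal_inf_adherent en fn; exists f.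
apply: (@le_trans _ _ (\sum_(n <oo) \sum_(k <oo) (I (f n k))%:E)%E).
  apply: daniell_outer_le.
  - by move=> i j; have [[]] := Pf i.
  - by move=> i j; have [[]] := Pf i.
  - move=> x [n _ Anx].
    have [[_ f0 /(_ _ Anx) fn] _] := Pf n.
    apply: (le_trans fn).
    rewrite [leRHS](@nneseriesD1 _ _ n)//; last first.
      move=> i _; apply: nneseries_ge0 => j _ _; rewrite lee_fin.
      by have [[]] := Pf i.
    rewrite leeDl//; apply: nneseries_ge0 => i _ _.
    apply: nneseries_ge0 => j _ _.
    by rewrite lee_fin; have [[]] := Pf i.
apply: lee_nneseries => [n _ _|n _]; last by have [] := Pf n.
apply: nneseries_ge0 => k _ _; rewrite lee_fin.
by have [[? ? _] _] := Pf n; exact: I_ge0.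
Qed.

HB.instance Definition _ := isOuterMeasure.Build R T daniell_outer
  daniell_outer0 daniell_outer_ge0 daniell_outer_homo
  daniell_outer_sigma_subadditive.

(* If the [f k] cover [X], the increments [f k * (u m.+1 - u m)] cover the part
   of [X] inside the open set, and [f k * (1 - u (N k))] the part outside; the
   total cost is that of [f] up to [e]. *)
Lemma caratheodory_positivity_set (h : T -> R) : continuous h ->
  (forall x, 0 <= h x) -> daniell_outer.-caratheodory [set x | 0 < h x].
Proof.
move=> ch h0; set A := [set x | 0 < h x].
apply: le_caratheodory_measurable => X.
apply: le_ereal_inf_tmp => _ [f [bf f0 fX] <-].
(* [u m] starts at 0 for [m = 0], increases with [m], equals 1 where [m * h x >= 1], and vanishes
   off [A]: it increases to the indicator of [A]. *)
pose u m x := Num.min (m%:R * h x) 1.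
have bu m : bounded_continuous (u m).
  apply: (@bounded_continuous_min _ _ (fun x => m%:R * h x) 1) => x.
    by apply: (@continuousM _ _ (fun=> m%:R) h x); [exact: cvg_cst|exact: ch].
  by rewrite mulr_ge0.
have u1 m x : u m x <= 1 by rewrite /u ge_min lexx orbT.
have u0 x : u 0 x = 0 by rewrite /u mul0r min_l.
have uS m x : u m x <= u m.+1 x.
  by rewrite /u le_min !ge_min lexx !orbT andbT ler_wpM2r// ler_nat.
pose v k m x := f k x * (u m.+1 x - u m x).
have bv k m : bounded_continuous (v k m).
  exact/bounded_continuousM/bounded_continuousB.
have v0 k m x : 0 <= v k m x by rewrite mulr_ge0// subr_ge0.
have bfu k N : bounded_continuous (fun x => f k x * u N x).
  exact: bounded_continuousM.
have sumv k N x : \sum_(m < N) v k m x = f k x * u N x.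
  elim: N => [|N ih]; first by rewrite big_ord0 u0 mulr0.
  by rewrite big_ord_recr/= ih /v -mulrDr addrC subrK.
have sumIv k N : \sum_(m < N) I (v k m) = I (fun x => f k x * u N x).
  rewrite -daniell_functional_sum//.
  by congr I; apply/funext => x; rewrite sumv.
pose l k := (\sum_(m <oo) (I (v k m))%:E)%E.
have Iv0 k m : (0 <= (I (v k m))%:E)%E by rewrite lee_fin I_ge0.
have l0 k : (0 <= l k)%E by exact: nneseries_ge0.
have l_le k (c : \bar R) :
    (forall N, (I (fun x => f k x * u N x))%:E <= c)%E -> (l k <= c)%E.
  move=> H; apply: lime_le; first exact: is_cvg_nneseries.
  apply: nearW => N; rewrite big_mkord.
  have -> : (\sum_(i < N) (I (v k i))%:E)%E = (\sum_(i < N) I (v k i))%:E.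
    by rewrite sumEFin.
  by rewrite sumIv.
have l_fin k : l k \is a fin_num.
  rewrite ge0_fin_numE//; apply: le_lt_trans (ltry (I (f k))).
  apply: l_le => N; rewrite lee_fin; apply: daniell_functional_le => // x.
  by rewrite ler_piMr.
apply/lee_addgt0Pr => e e0.
apply: le_trans (epsilon_trick _ _ _); last 2 first.
- by move=> n; rewrite lee_fin I_ge0.
- exact: ltW.
(* [l k] is the supremum over [N] of [I (f k * u N)]. If no [N] came within [e / 2 ^ k.+1] of it,
   [l k] would be bounded by itself minus this positive amount. *)
have [N lN] : {N : nat -> nat & forall k,
    (l k <= (I (fun x => f k x * u (N k) x) + e / (2 ^ k.+1)%:R)%:E)%E}.
  apply: (@choice _ _ (fun k N =>
    (l k <= (I (fun x => f k x * u N x) + e / (2 ^ k.+1)%:R)%:E)%E)) => k.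
  apply: contrapT => /forallNP H.
  have ek : 0 < e / (2 ^ k.+1)%:R :> R by rewrite divr_gt0// ltr0n expn_gt0.
  have : (l k <= l k - (e / (2 ^ k.+1)%:R)%:E)%E.
    apply: l_le => N; have /negP := H N; rewrite -ltNge => /ltW.
    by rewrite EFinD leeBrDr.
  rewrite -[l k]fineK// -EFinB lee_fin lerBrDr gerDl.
  by rewrite leNgt ek.
pose g k x := f k x * (1 - u (N k) x).
have bg k : bounded_continuous (g k).
  apply: bounded_continuousM => //; apply: bounded_continuousB => //.
  exact: bounded_continuous_cst.
have g0 k x : 0 <= g k x by rewrite mulr_ge0// subr_ge0.
apply: (@le_trans _ _ (\sum_(k <oo) l k + \sum_(k <oo) (I (g k))%:E)%E).
  apply: leeD.
    apply: daniell_outer_le => // x [/fX fx hx].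
    apply: (le_trans fx); apply: lee_nneseries => [k _ _|k _].
      by rewrite lee_fin.
    (* In [A] the increments telescope to [f k x] after finitely many steps. *)
    have [m hm] : exists m, 1 <= m%:R * h x.
      exists (Num.truncn (h x)^-1).+1; rewrite -ler_pdivrMr// div1r.
      exact/ltW/truncnS_gt.
    apply: (@le_trans _ _ (\sum_(0 <= j < m) (v k j x)%:E)%E); last first.
      by apply: nneseries_lim_ge => j _ _; rewrite lee_fin.
    by rewrite big_mkord sumEFin sumv /u min_r// mulr1.
  apply: ereal_inf_lbound; exists g => //; split => // x [/fX fx hx].
  apply: (le_trans fx); apply: lee_nneseries => [k _ _|k _].
    by rewrite lee_fin.
  have /eqP hx0 : h x == 0 by rewrite eq_le h0 leNgt andbT; apply/negP.
  by rewrite /g /u hx0 mulr0 min_l// subr0 mulr1.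
rewrite -nneseriesD//; last by move=> k _ _; rewrite lee_fin I_ge0.
apply: lee_nneseries => [k _ _|k _].
  by rewrite adde_ge0// lee_fin I_ge0.
have -> : I (g k) = I (f k) - I (fun x => f k x * u (N k) x).
  rewrite -daniell_functionalB//; congr I; apply/funext => x /=.
  by rewrite /g mulrBr mulr1.
rewrite -[l k]fineK// -!EFinD lee_fin.
have := lN k; rewrite -[l k]fineK// lee_fin.
lra.
Qed.

(** By [openP] every open set is a positivity set, hence Caratheodory measurable, and the Borel sets
    follow. [I_tight] replaces compactness of the space in the computation of the total mass. *)
Hypothesis openP : forall U : set T, open U -> exists h : T -> R,
  [/\ continuous h, forall x, 0 <= h x & U = [set x | 0 < h x]].
Hypothesis I_tight : forall e, 0 < e -> exists2 K : set T, compact K &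
  forall f, bounded_continuous f -> (forall x, 0 <= f x <= 1) ->
    (forall x, K x -> f x = 0) -> I f <= e.

Definition daniell_measure (A : set (g_sigma_algebraType (@open T))) : \bar R :=
  daniell_outer A.

Let borel_caratheodory (A : set (g_sigma_algebraType (@open T))) :
  measurable A -> daniell_outer.-caratheodory A.
Proof.
move: A; apply: smallest_sub.
  split.
  - exact: caratheodory_measurable_set0.
  - by move=> A mA; rewrite setTD; exact: caratheodory_measurable_setC.
  - by move=> F mF; exact: caratheodory_measurable_bigcup.
by move=> U /openP[h [ch h0 ->]]; exact: caratheodory_positivity_set.
Qed.

Let daniell_measure0 : daniell_measure set0 = 0%E.
Proof. exact: daniell_outer0. Qed.

Let daniell_measure_ge0 A : (0 <= daniell_measure A)%E.
Proof. exact: daniell_outer_ge0. Qed.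

Let daniell_measure_semi_sigma_additive : semi_sigma_additive daniell_measure.
Proof.
move=> F mF tF mUF; apply: caratheodory_measure_sigma_additive => //.
- by move=> i; apply: borel_caratheodory; exact: mF.
- exact: borel_caratheodory.
Qed.

HB.instance Definition _ := isMeasure.Build _ _ _ daniell_measure
  daniell_measure0 daniell_measure_ge0 daniell_measure_semi_sigma_additive.

(** The constant 1 is a cover, which bounds the mass from above. Conversely, a Dini argument on a
    compact [K] shows that finitely many terms of any cover reach [1 - d] on [K], and tightness
    makes the deficit outside [K] cheap. *)
Lemma daniell_measureT : daniell_measure setT = (I (fun=> 1))%:E.
Proof.
apply/eqP; rewrite eq_le; apply/andP; split.
  apply: daniell_outer1 => //; exact: bounded_continuous_cst.
apply: le_ereal_inf_tmp => _ [f [bf f0 fT] <-].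
apply/lee_addgt0Pr => e e0.
have b1 : bounded_continuous (fun _ : T => 1 : R).
  exact: bounded_continuous_cst.
have I1_ge0 : 0 <= I (fun=> 1) by exact: I_ge0.
(* Chosen so that [d + d * I 1 = e]: one [d] pays for the deficit outside [K], and [d * I 1] for
   replacing 1 by [1 - d]. *)
pose d := e / (1 + I (fun=> 1)).
have d0 : 0 < d by rewrite divr_gt0// ltr_pwDl.
have [K cK tK] := I_tight d0.
pose s N x := \sum_(k < N) f k x.
have bs N : bounded_continuous (s N) by exact: bounded_continuous_sum.
have sS N M x : (N <= M)%N -> s N x <= s M x.
  move=> /subnK <-; elim: (M - N)%N => [|m ih]; first by rewrite add0n.
  by rewrite addSn /s big_ord_recr/= (le_trans ih)// lerDl.
have [N sN] : exists N, forall x, K x -> 1 - d <= s N x.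
  have := cK; rewrite compact_cover.
  move=> /(_ nat setT (fun N => [set x | 1 - d < s N x])).
  case.
  - move=> N _; apply: (@open_comp _ _ (s N) [set y | 1 - d < y]).
      by move=> x _; have [+ _] := bs N; exact.
    exact: open_gt.
  - move=> x Kx; apply: contrapT => H.
    have := fT x Logic.I; apply/negP; rewrite -ltNge.
    apply: (@le_lt_trans _ _ (1 - d)%:E); last by rewrite lte_fin gtrBl.
    apply: lime_le.
      by apply: is_cvg_nneseries => k _ _; rewrite lee_fin.
    apply: nearW => N; rewrite big_mkord sumEFin lee_fin leNgt.
    by apply/negP => sN; apply: H; exists N.
  - move=> D _ + ; have /finite_seqP[l ->] := finite_fset D => Kl.
    exists (\max_(i <- l) i)%N => x /Kl[i il /= sx].
    apply: (le_trans (ltW sx)); apply: sS.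
    by apply: (@leq_bigmax_seq _ _ _ (fun i => i)).
(* The deficit of the partial sum [s N] with respect to [1 - d]; it vanishes on [K], so tightness
   gives [I r <= d]. *)
pose r x := Num.max (1 - d - s N x) 0.
have br : bounded_continuous r.
  split.
    move=> x; apply: (@continuous_max _ _ (fun x => 1 - d - s N x) (fun=> 0)).
      have b1d := bounded_continuous_cst T (1 - d).
      have [+ _] := bounded_continuousB b1d (bs N).
      exact.
    exact: cst_continuous.
  exists 1 => x; rewrite ger0_norm ?le_max ?lexx ?orbT//.
  rewrite ge_max ler01 andbT; have : 0 <= s N x by exact: sumr_ge0.
  lra.
have r01 x : 0 <= r x <= 1.
  rewrite /r le_max lexx orbT/= ge_max ler01 andbT.
  have : 0 <= s N x by exact: sumr_ge0.
  lra.
have rK x : K x -> r x = 0.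
  by move=> /sN sx; rewrite /r max_r// subr_le0.
have Ir := tK r br r01 rK.
have le1 : I (fun=> 1) <= I (s N) + (I r + d * I (fun=> 1)).
  have bd : bounded_continuous (fun _ : T => d * 1).
    exact: bounded_continuousZ.
  have brd : bounded_continuous (r \+ (fun=> d * 1)).
    exact: bounded_continuousD.
  rewrite -IZ// -!ID//.
  apply: daniell_functional_le => // [|x /=].
    exact: bounded_continuousD.
  have : 1 - d - s N x <= r x by rewrite le_max lexx.
  lra.
have de : d + d * I (fun=> 1) = e.
  by rewrite -[X in X + _]mulr1 -mulrDr divfK// gt_eqF// ltr_pwDl.
apply: (@le_trans _ _ (I (s N) + e)%:E).
  by rewrite lee_fin (le_trans le1)// lerD2l -de lerD2r.
rewrite EFinD leeD2r// daniell_functional_sum// -sumEFin.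
rewrite -(big_mkord xpredT (fun k => (I (f k))%:E)).
by apply: nneseries_lim_ge => k _ _; rewrite lee_fin I_ge0.
Qed.


Let integrable_bounded f : bounded_continuous f ->
  daniell_measure.-integrable setT (EFin \o f).
Proof.
move=> [cf [M fM]]; apply: measurable_bounded_integrable => //.
- by rewrite [ltLHS]daniell_measureT ltry.
- exact: continuous_borel_measurable.
- exists M; split; first exact: num_real.
  by move=> N MN x _ /=; rewrite (le_trans (fM x))// ltW.
Qed.

(** The integral of each layer is compared with [I] of the layer just below it; this shift by one
    layer costs only [e * I 1], the price of the bottom layer. *)
Let integral_daniell_measure_le f : bounded_continuous f ->
  (forall x, 0 <= f x) ->
  (\int[daniell_measure]_x (f x)%:E <= (I f)%:E)%E.
Proof.
move=> bf f0; have [cf [M fM]] := bf.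
apply/lee_addgt0Pr => e0 e00.
have I1_ge0 : 0 <= I (fun=> 1).
  by apply: I_ge0 => //; exact: bounded_continuous_cst.
pose e := e0 / (1 + I (fun=> 1)).
have e_gt0 : 0 < e by rewrite divr_gt0// ltr_pwDl.
have ee0 : e * (1 + I (fun=> 1)) = e0.
  by rewrite divfK// gt_eqF// ltr_pwDl.
clearbody e.
(* Layer cake: [t n] is the layer of the graph of [f] between the heights
   [n * e] and [(n + 1) * e], and [t n.+1 <= e <= t n] where [t n.+1 > 0]. *)
pose s n x := Num.min (f x) (n%:R * e).
have bs n : bounded_continuous (s n) by exact: bounded_continuous_min.
have s0 x : s 0 x = 0 by rewrite /s mul0r min_r.
pose t n x := s n.+1 x - s n x.
have bt n : bounded_continuous (t n) by exact: bounded_continuousB.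
have mb (h : T -> R) : bounded_continuous h ->
    measurable_fun [set: g_sigma_algebraType (@open T)]
      ((fun x => (h x)%:E) : g_sigma_algebraType (@open T) -> \bar R).
  by move=> [ch _]; apply/measurable_EFinP; exact: continuous_borel_measurable.
have ne n : n.+1%:R * e = n%:R * e + e by rewrite -natr1 mulrDl mul1r.
have sE n x : [\/ s n x = f x /\ s n.+1 x = f x /\ f x <= n%:R * e,
    [/\ s n x = n%:R * e, s n.+1 x = f x & n%:R * e < f x <= n%:R * e + e] |
    [/\ s n x = n%:R * e, s n.+1 x = n%:R * e + e & n%:R * e + e < f x]].
  rewrite /s ne; have [fn|fn] := leP (f x) (n%:R * e).
    by apply: Or31; rewrite min_l// (le_trans fn)// lerDl ltW.
  have [fn1|fn1] := leP (f x) (n%:R * e + e).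
    by apply: Or32; split; rewrite ?fn ?fn1.
  by apply: Or33.
have t01 n x : 0 <= t n x <= e.
  by rewrite /t; case: (sE n x) => [[-> [->]]|[-> ->]|[-> ->]]; lra.
(* [t n.+1] is at most [e] and lives on [E], where the layer below is full, [t n = e]. Hence
   [e^-1 * t n] is a one-function cover of [E]. *)
have step n : (\int[daniell_measure]_x (t n.+1 x)%:E <= (I (t n))%:E)%E.
  pose E : set (g_sigma_algebraType (@open T)) := [set x | n.+1%:R * e < f x].
  have mE : measurable E.
    rewrite -[E]setTI; have := continuous_borel_measurable cf.
    have -> : E = f @^-1` `]n.+1%:R * e, +oo[%classic.
      by apply/seteqP; split => x /=; rewrite in_itv/= andbT.
    by apply => //; exact: measurable_itv.
  apply: (@le_trans _ _ (\int[daniell_measure]_x (e * \1_E x)%:E)%E).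
    apply: ge0_le_integral => //.
    - by move=> x _; rewrite lee_fin; have /andP[] := t01 n.+1 x.
    - exact: mb.
    - by apply/measurable_EFinP; exact: measurable_funM.
    - move=> x _; rewrite lee_fin indicE.
      have /andP[_ te] := t01 n.+1 x.
      have [xE|] := boolP (x \in E); first by rewrite mulr1.
      rewrite notin_setE /E /= mulr0 => /negP; rewrite -leNgt => fx.
      rewrite /t; case: (sE n.+1 x) => [[-> [->]]|[_ _]|[_ _]]; lra.
  rewrite (@integralZl_indic _ _ _ _ _ _ (fun=> E))//; last first.
    by move=> /lt_geF; rewrite ltW.
  rewrite integral_indic// setIT.
  have -> : I (t n) = e * I (fun x => e^-1 * t n x).
    by rewrite IZ// mulrA divff ?gt_eqF// mul1r.
  rewrite EFinM lee_pmul2l// ?lte_fin//; apply: daniell_outer1.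
  - exact: bounded_continuousZ.
  - by move=> x; have /andP[? _] := t01 n x; rewrite mulr_ge0// invr_ge0 ltW.
  - move=> x /=; rewrite /E/= ne => fx; rewrite mulrC ler_pdivlMr// mul1r.
    by rewrite /t; case: (sE n x) => [[-> [->]]|[-> ->]|[-> ->]]; lra.
have intS n : (\int[daniell_measure]_x (s n.+1 x)%:E <=
    (e * I (fun=> 1) + I (s n))%:E)%E.
  elim: n => [|n ih].
    apply: (@le_trans _ _ (\int[daniell_measure]_x (cst e%:E x))%E).
      apply: ge0_le_integral => //.
      - by move=> x _; rewrite lee_fin /s le_min f0 mul1r ltW.
      - exact: mb.
      - by move=> x _; rewrite lee_fin /s mul1r ge_min lexx orbT.
    rewrite integral_cst//= daniell_measureT -EFinM lee_fin lerDl.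
    by apply: I_ge0 => // x; rewrite s0.
  have -> : (\int[daniell_measure]_x (s n.+2 x)%:E =
     \int[daniell_measure]_x ((s n.+1 x)%:E + (t n.+1 x)%:E))%E.
    by apply: eq_integral => x _; rewrite -EFinD /t addrC subrK.
  rewrite ge0_integralD//; last 4 first.
  - by move=> x _; rewrite lee_fin /s le_min f0 mulr_ge0// ltW.
  - exact: mb.
  - by move=> x _; rewrite lee_fin; have /andP[] := t01 n.+1 x.
  - exact: mb.
  apply: (le_trans (leeD ih (step n))).
  rewrite -EFinD lee_fin -addrA -ID// le_eqVlt; apply/orP; left; apply/eqP.
  by congr (_ + I _); apply/funext => x; rewrite /= /t addrC subrK.
have [N MN] : exists N : nat, M <= N.+1%:R * e.
  exists (Num.truncn (M / e)); rewrite -ler_pdivrMr//; exact/ltW/truncnS_gt.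
have -> : (\int[daniell_measure]_x (f x)%:E =
    \int[daniell_measure]_x (s N.+1 x)%:E)%E.
  apply: eq_integral => x _; rewrite /s min_l// (le_trans _ MN)//.
  by rewrite (le_trans (ler_norm _)).
apply: (le_trans (intS N)); rewrite -EFinD lee_fin addrC lerD//.
  apply: daniell_functional_le => // x.
  by rewrite /s ge_min lexx.
by rewrite -ee0 ler_pM2l// lerDr.
Qed.

(** The one-sided bound applies to the nonnegative functions [M + f] and [M - f]. As constants are
    integrated exactly, it yields both inequalities for [f]. *)
Lemma integral_daniell_measure f : bounded_continuous f ->
  (\int[daniell_measure]_x (f x)%:E = (I f)%:E)%E.
Proof.
move=> bf; have [cf [M fM]] := bf.
have bM := bounded_continuous_cst T M.
have Mf x : - M <= f x <= M by rewrite -ler_norml.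
have IM : I (fun=> M) = M * I (fun=> 1).
  rewrite -IZ; last exact: bounded_continuous_cst.
  by congr I; apply/funext => x; rewrite mulr1.
have intM : (\int[daniell_measure]_x M%:E = (M * I (fun=> 1))%:E)%E.
  by rewrite (integral_cst _ _ M%:E)//= daniell_measureT.
have iM := integrable_bounded bM; have i_f := integrable_bounded bf.
have h1 : (\int[daniell_measure]_x (M%:E + (f x)%:E) <=
    (I (fun x => M + f x))%:E)%E.
  apply: integral_daniell_measure_le; first exact: bounded_continuousD.
  by move=> x; have := Mf x; lra.
have h2 : (\int[daniell_measure]_x (M%:E - (f x)%:E) <=
    (I (fun x => M - f x))%:E)%E.
  apply: integral_daniell_measure_le; first exact: bounded_continuousB.
  by move=> x; have := Mf x; lra.
have ffin : (\int[daniell_measure]_x (f x)%:E \is a fin_num)%E.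
  exact: integrable_fin_num i_f.
move: h1 h2; rewrite integralD_EFin// integralB_EFin// intM.
have -> : I (fun x => M + f x) = I (fun=> M) + I f by rewrite -ID.
have -> : I (fun x => M - f x) = I (fun=> M) - I f.
  by rewrite -daniell_functionalB.
rewrite IM -(fineK ffin) -EFinD -EFinB !lee_fin => h1 h2.
by congr EFin; lra.
Qed.

Theorem riesz_representation :
  exists mu : {measure set (g_sigma_algebraType (@open T)) -> \bar R},
    forall f, bounded_continuous f -> (\int[mu]_x (f x)%:E = (I f)%:E)%E.
Proof. by exists daniell_measure => f; exact: integral_daniell_measure. Qed.

End daniell.

(** * Prokhorov's theorem *)

(** Compactness of the segment gives a cluster point [p], and along an ultrafilter a cluster point
    is a limit: if the preimage of a neighbourhood of [p] were not in [U], its complement would be,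
    against clustering. *)
Lemma ultrafilter_bounded_cvg (R : realType) (J : Type) (U : set_system J)
    (a : J -> R) (M : R) : UltraFilter U ->
  (\forall j \near U, `|a j| <= M) -> cvg (a @ U).
Proof.
move=> UU aM; have FU := @ultra_proper _ _ UU.
have [p [_ clp]] : [set` `[- M, M]] `&` cluster (a @ U) !=set0.
  apply: (@segment_compact R (- M) M).
  by apply: filterS aM => j; rewrite ler_norml /= in_itv.
apply/cvg_ex; exists p => V Vp.
have [//|nV] := in_ultra_setVsetC (a @^-1` V) UU.
by have [q [/(_ _)]] := clp (~` V) V nV Vp.
Qed.

Section integral_bounded_continuous.
Context (R : realType) (T : ptopologicalType).
Variable nu : {measure set (g_sigma_algebraType (@open T)) -> \bar R}.
Hypothesis nu1 : nu setT = 1%E.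

Lemma bounded_continuous_integrable f : bounded_continuous f ->
  nu.-integrable setT (EFin \o f).
Proof.
move=> [cf [M fM]]; apply: measurable_bounded_integrable => //.
- by rewrite [ltLHS]nu1 ltry.
- exact: continuous_borel_measurable.
- exists M; split; first exact: num_real.
  by move=> N MN x _ /=; rewrite (le_trans (fM x))// ltW.
Qed.

Lemma bounded_continuous_integral_fin_num f : bounded_continuous f ->
  (\int[nu]_x (f x)%:E)%E \is a fin_num.
Proof. by move/bounded_continuous_integrable/integrable_fin_num; apply. Qed.

Lemma probability_integral_cst (c : R) : (\int[nu]_x c%:E = c%:E)%E.
Proof. by rewrite (integral_cst _ _ c%:E)//= nu1 mule1. Qed.

Lemma fine_integralD f g : bounded_continuous f -> bounded_continuous g ->
  fine (\int[nu]_x (f x + g x)%:E)%E =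
  fine (\int[nu]_x (f x)%:E) + fine (\int[nu]_x (g x)%:E).
Proof.
move=> bf bg; under eq_integral do rewrite EFinD.
rewrite integralD_EFin//; try exact: bounded_continuous_integrable.
by rewrite fineD//; exact: bounded_continuous_integral_fin_num.
Qed.

Lemma fine_integralZ c f : bounded_continuous f ->
  fine (\int[nu]_x (c * f x)%:E)%E = c * fine (\int[nu]_x (f x)%:E).
Proof.
move=> bf; under eq_integral do rewrite EFinM.
rewrite integralZl//; last exact: bounded_continuous_integrable.
by rewrite fineM//; exact: bounded_continuous_integral_fin_num.
Qed.

Lemma fine_integral_ge0 (f : T -> R) : (forall x, 0 <= f x) ->
  0 <= fine (\int[nu]_x (f x)%:E)%E.
Proof.
by move=> f0; apply: fine_ge0; apply: integral_ge0 => x _; rewrite lee_fin.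
Qed.

Lemma fine_integral_le (f : T -> R) M : continuous f ->
  (forall x, `|f x| <= M) -> `|fine (\int[nu]_x (f x)%:E)%E| <= M.
Proof.
move=> cf fM; have bf : bounded_continuous f by split=> //; exists M.
rewrite -lee_fin -abse_EFin fineK ?bounded_continuous_integral_fin_num//.
apply: (le_trans (le_abse_integral _ _ _)) => //.
  by apply/measurable_EFinP; exact: continuous_borel_measurable.
rewrite -[leRHS](probability_integral_cst M); apply: ge0_le_integral => //.
  apply: measurableT_comp => //.
  by apply/measurable_EFinP; exact: continuous_borel_measurable.
by move=> x _; rewrite /= lee_fin.
Qed.

End integral_bounded_continuous.

Section prokhorov.
Context (R : realType) (T : ptopologicalType) (J : Type) (U : set_system J).
Context {UU : UltraFilter U}.
Variable nu : J -> {measure set (g_sigma_algebraType (@open T)) -> \bar R}.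
Hypothesis openP : forall V : set T, open V -> exists h : T -> R,
  [/\ continuous h, forall x, 0 <= h x & V = [set x | 0 < h x]].
Hypothesis nu1 : \forall j \near U, nu j setT = 1%E.
Hypothesis nu_tight : forall e, 0 < e -> exists2 K : set T, compact K &
  forall f, bounded_continuous f -> (forall x, 0 <= f x <= 1) ->
    (forall x, K x -> f x = 0) ->
    \forall j \near U, fine (\int[nu j]_x (f x)%:E)%E <= e.

Let I (f : T -> R) : R := lim ((fun j => fine (\int[nu j]_x (f x)%:E)%E) @ U).

Let FU : ProperFilter U := @ultra_proper _ _ UU.

Let cvgI f : bounded_continuous f ->
  ((fun j => fine (\int[nu j]_x (f x)%:E)%E) @ U --> I f).
Proof.
move=> [cf [M fM]]; apply: (@ultrafilter_bounded_cvg _ _ _ _ M) => //.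
by apply: filterS nu1 => j nuj; exact: fine_integral_le.
Qed.

(** The limit [I] of the integrals along [U] exists for every bounded continuous function and
    inherits linearity, positivity and tightness, so Riesz representation applies to it. *)
Theorem prokhorov :
  exists mu : {measure set (g_sigma_algebraType (@open T)) -> \bar R},
    mu setT = 1%E /\
    forall f, bounded_continuous f ->
      ((fun j => fine (\int[nu j]_x (f x)%:E)%E) @ U -->
        fine (\int[mu]_x (f x)%:E)%E).
Proof.
have I1 : I (fun=> 1) = 1.
  apply/cvg_lim => //; apply: cvg_near_cst.
  by apply: filterS nu1 => j nuj; rewrite probability_integral_cst.
have [] := @riesz_representation R T I.
- move=> f g bf bg; apply/cvg_lim => //.
  apply: cvg_trans (cvgD (cvgI bf) (cvgI bg)).
  apply: near_eq_cvg; apply: filterS nu1 => j nuj.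
  by rewrite fine_integralD.
- move=> c f bf; apply/cvg_lim => //.
  apply: cvg_trans (cvgM (cvg_cst c) (cvgI bf)).
  apply: near_eq_cvg; apply: filterS nu1 => j nuj.
  by rewrite fine_integralZ.
- move=> f bf f0; apply: limr_ge; first exact: cvgI.
  by apply: nearW => j; exact: fine_integral_ge0.
- exact: openP.
- move=> e e0; have [K cK tK] := nu_tight e0; exists K => // f bf f01 fK.
  apply: limr_le; first exact: cvgI.
  exact: tK.
move=> mu muE; exists mu; split; last first.
  by move=> f bf; rewrite muE//; exact: cvgI.
have := muE _ (bounded_continuous_cst T 1).
by rewrite (integral_cst _ _ 1%E)//= mul1e I1.
Qed.

End prokhorov.

(* Without this, [Omega] has no pointed topological structure. *)
HB.instance Definition _ (T U : ptopologicalType) :=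
  Pointed.on (T * U)%type.

(** * The torus *)

Section inner_radius.
Context (R : realType) (V : normedModType R) (W : set V).

Let radii p : set R := [set r | 0 <= r <= 1 /\ ball p r `<=` W].

Definition inner_radius (p : V) : R := sup (radii p).

Let radii0 p : radii p 0.
Proof.
split; first by rewrite lexx ler01.
by move=> q; rewrite -ball_normE /= ltNge normr_ge0.
Qed.

Let has_sup_radii p : has_sup (radii p).
Proof.
split; last by exists 1 => r [/andP[]].
by exists 0.
Qed.

Let le_inner_radius p r : radii p r -> r <= inner_radius p.
Proof. by move=> pr; apply: ub_le_sup => //; have [] := has_sup_radii p. Qed.

Lemma inner_radius_ge0 p : 0 <= inner_radius p.
Proof.  exact: le_inner_radius. Qed.

Let inner_radius_lipschitz p q : inner_radius p <= inner_radius q + `|p - q|.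
Proof.
apply: ge_sup; first by have [] := has_sup_radii p.
move=> r [/andP[r0 r1] rW]; rewrite -lerBlDr.
have [rpq|rpq] := leP (r - `|p - q|) 0.
  by rewrite (le_trans rpq)// inner_radius_ge0.
apply: le_inner_radius; split; first by rewrite ltW//= lerBlDr ler_wpDr.
move=> z; rewrite -ball_normE /= => qz; apply: rW; rewrite -ball_normE /=.
by rewrite (le_lt_trans (ler_distD q _ _))// -ltrBrDl.
Qed.

Lemma inner_radius_continuous : continuous inner_radius.
Proof.
move=> p; apply/cvgrPdist_lt => e e0; near=> q.
have pq : `|p - q| < e by near: q; exact: cvgr_dist_lt.
rewrite (le_lt_trans _ pq)// ler_norml lerBlDl inner_radius_lipschitz andbT.
by rewrite lerNl opprB lerBlDl distrC inner_radius_lipschitz.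
Unshelve. all: by end_near. Qed.

Lemma inner_radius_gt0 : open W -> W = [set p | 0 < inner_radius p].
Proof.
move=> oW; apply/seteqP; split => [p Wp|p /= ]; last first.
  move=> /sup_adherent/(_ (has_sup_radii p)) [r [_ rW]].
  rewrite subrr => r0; apply: rW; exact: ballxx.
have /nbhs_ballP[e e0 eW] := open_nbhs_nbhs (conj oW Wp).
apply: (@lt_le_trans _ _ (Num.min e 1)); first by rewrite lt_min e0 ltr01.
apply: le_inner_radius; split.
  by rewrite le_min ge_min lexx orbT ler01 (ltW e0).
by apply: subset_trans eW; apply: le_ball; rewrite ge_min lexx.
Qed.

Lemma inner_radius_translate p k : (forall q, W (q + k) <-> W q) ->
  inner_radius (p + k) = inner_radius p.
Proof.
move=> Wk; congr sup; apply/seteqP; split => r [r01 rW]; split => // q.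
  rewrite -ball_normE /= => pq; apply/Wk/rW.
  by rewrite -ball_normE /= opprD addrACA subrr addr0.
rewrite -ball_normE /= => pq; rewrite -(subrK k q); apply/Wk/rW.
by rewrite -ball_normE /= opprB addrA.
Qed.

End inner_radius.

Section torus_topology.
Context (R : realType) (n : nat).
Implicit Types x y : 'rV[R]_n.

Lemma to_torusP x y : reflect (to_torus x = to_torus y) (int_translate x y).
Proof. exact: eqquotP. Qed.

Lemma repr_torus x : int_translate (repr (to_torus x)) x.
Proof. by apply/to_torusP; rewrite /to_torus reprK. Qed.

Lemma to_torus_repr (t : torus R n) : to_torus (repr t) = t.
Proof. exact: reprK. Qed.

Lemma to_torus_continuous : continuous (@to_torus R n).
Proof. exact: pi_continuous. Qed.

Lemma cvg_translate y c : (fun z : 'rV[R]_n => z + c) @ y --> y + c.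
Proof.
have F : Filter (nbhs y) by exact: _.
by apply: (@cvgD R 'rV[R]_n _ _ F); [exact: cvg_id|exact: cvg_cst].
Qed.

(** Near [y], translation by the integer vector [x - y] lands in [A] without changing the class.
    Openness of the projection lets neighbourhoods in the quotient be computed on lifts. *)
Lemma to_torus_open (A : set 'rV[R]_n) : open A -> open (@to_torus R n @` A).
Proof.
move=> oA; rewrite /open/= /quotient_open openE => y [x Ax /to_torusP xy].
have xy_eq z : to_torus (z + (x - y)) = to_torus z.
  apply/to_torusP/forallP => i; rewrite !mxE [_ + _ - _]addrC addrA addNr add0r.
  by have /forallP/(_ i) := xy.
have cz := @cvg_translate y (x - y).
have yxy : y + (x - y) = x by rewrite addrC subrK.
rewrite yxy in cz.
have : \forall z \near y, A (z + (x - y)) by apply: cz; exact: open_nbhs_nbhs.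
by apply: filterS => z Az; exists (z + (x - y)) => //; rewrite xy_eq.
Qed.

Lemma to_torus_nbhs x (A : set 'rV[R]_n) : nbhs x A ->
  nbhs (to_torus x) (@to_torus R n @` A).
Proof.
rewrite nbhsE => -[B [oB Bx] BA].
rewrite nbhsE; exists (@to_torus R n @` B).
  by split; [exact: to_torus_open|exists x].
exact: image_subset.
Qed.

Lemma fractional_part x : exists2 y, to_torus y = to_torus x &
  forall i, y 0 i \in `[0, 1].
Proof.
exists (\row_i (x 0 i - (Num.floor (x 0 i))%:~R)).
  apply/to_torusP/forallP => i; rewrite mxE addrAC subrr add0r.
  by rewrite rpredN intr_int.
move=> i; rewrite mxE in_itv/= subr_ge0 floor_le_tmp lerBlDr addrC.
by rewrite -intrD1 ltW// floorD1_gt.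
Qed.

Lemma torus_compact : compact [set: torus R n].
Proof.
have -> : [set: torus R n] =
    @to_torus R n @` [set v : 'rV[R]_n | forall i, `[0, 1]%classic (v ord0 i)].
  apply/seteqP; split => // t _.
  have [y yt y01] := fractional_part (repr t).
  by exists y => //; rewrite yt to_torus_repr.
apply: continuous_compact; first exact/continuous_subspaceT/to_torus_continuous.
apply: (@rV_compact R n (fun=> `[0, 1]%classic)) => i.
exact: segment_compact.
Qed.

Definition to_Omega (p : 'rV[R]_n * 'rV[R]_n) : Omega R n :=
  (to_torus p.1, p.2).

Lemma to_Omega_continuous : continuous to_Omega.
Proof.
move=> p; have F : Filter (nbhs p) by exact: _.
have c1 : to_torus q.1 @[q --> p] --> to_torus p.1.
  by apply: continuous_comp; [exact: cvg_fst|exact: to_torus_continuous].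
have c2 : q.2 @[q --> p] --> p.2 by exact: cvg_snd.
exact: (cvg_pair c1 c2).
Qed.

Lemma zero_section_continuous :
  continuous (fun x : 'rV[R]_n => to_Omega (x, 0)).
Proof.
move=> x; have F : Filter (nbhs x) by exact: _.
have c1 : y @[y --> x] --> x by exact: cvg_id.
have c2 : (fun=> 0 : 'rV[R]_n) @ x --> (0 : 'rV[R]_n) by exact: cvg_cst.
exact: (continuous_comp (cvg_pair c1 c2) (@to_Omega_continuous (x, 0))).
Qed.

(** The product of a quotient map with an identity need not be a quotient map; here it behaves like
    one because [to_torus] is open. *)
Lemma Omega_continuous (Z : topologicalType) (f : Omega R n -> Z) :
  continuous (f \o to_Omega) -> continuous f.
Proof.
move=> cf [t v]; rewrite -(to_torus_repr t); set x := repr t.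
move=> B /(cf (x, v)) [[A1 A2] /= [nA1 nA2] AB].
exists (@to_torus R n @` A1, A2); first by split => //; exact: to_torus_nbhs.
by move=> [_ w] /= [[y Ay <-] Aw]; exact: (AB (y, w)).
Qed.

(** The lift of [V] is invariant under integer translations in [x], hence so is its [inner_radius],
    which therefore descends to [Omega]. No metric on the torus is involved. *)
Lemma Omega_openP (V : set (Omega R n)) : open V -> exists h : Omega R n -> R,
  [/\ continuous h, forall z, 0 <= h z & V = [set z | 0 < h z]].
Proof.
move=> oV; pose W := to_Omega @^-1` V.
have oW : open W by apply: open_comp => // p _; exact: to_Omega_continuous.
pose h := inner_radius W.
have hK x v : h (repr (to_torus x), v) = h (x, v).
  pose k : 'rV[R]_n * 'rV[R]_n := (repr (to_torus x) - x, 0).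
  have -> : (repr (to_torus x), v) = (x, v) + k.
    by congr pair; rewrite /= ?addr0// addrC subrK.
  apply: inner_radius_translate => -[y u].
  rewrite /W /to_Omega /= addr0.
  suff -> : to_torus (y + (repr (to_torus x) - x)) = to_torus y by [].
  apply/to_torusP/forallP => i; rewrite !mxE [_ + _ - _]addrC addrA addNr add0r.
  by have /forallP/(_ i) := repr_torus x.
exists (fun z => h (repr z.1, z.2)); split.
- apply: Omega_continuous => p.
  have -> : (fun z => h (repr z.1, z.2)) \o to_Omega = h.
    by apply/funext => -[x v] /=; rewrite hK.
  exact: inner_radius_continuous.
- by move=> z; exact: inner_radius_ge0.
- apply/seteqP; split => -[t v]; rewrite -(to_torus_repr t) /= hK;
    set x := repr t.
    by move=> Vz; have : W (x, v) by []; rewrite (inner_radius_gt0 oW).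
  by move=> hx; suff : W (x, v) by []; rewrite (inner_radius_gt0 oW).
Qed.

End torus_topology.

(** * Euclidean norm, weight and Lagrangian on [Omega] *)

Lemma cvgr_sum (R : realType) (T : Type) (F : set_system T) (FF : Filter F)
    (I : Type) (r : seq I) (f : I -> T -> R) (l : I -> R) :
  (forall i, f i @ F --> l i) ->
  \sum_(i <- r) f i x @[x --> F] --> \sum_(i <- r) l i.
Proof.
move=> fl; elim: r => [|i r ih].
  by under eq_fun do rewrite big_nil; rewrite big_nil; exact: cvg_cst.
under eq_fun do rewrite big_cons.
by rewrite big_cons; exact: cvgD (fl i) ih.
Qed.

(** Composition with the retraction of the line onto the half-line makes the continuity global. It
    serves for the weight profile and for Brownian paths. *)
Lemma continuous_max0 (R : realType) (Z : topologicalType) (f : R -> Z) :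
  {within `[0, +oo[, continuous f} ->
  continuous (fun s : R => f (Num.max s 0)).
Proof.
move=> cf s A fA.
have ms0 (y : R) : Num.max y 0 \in `[0, +oo[ :> bool.
  by rewrite in_itv/= andbT le_max lexx orbT.
have := (subspace_continuousP _ _).1 cf _ (ms0 s) A fA.
have cm : (fun y : R => Num.max y 0) @ s --> Num.max s 0.
  apply: (@continuous_max _ _ id (fun=> 0)); first exact: cvg_id.
  exact: cvg_cst.
move=> /cm; rewrite /= !near_simpl /=.
by apply: filterS => y /(_ (ms0 y)).
Qed.

Section enorm.
Context (R : realType) (n : nat).
Implicit Types v : 'rV[R]_n.

Lemma enorm_ge0 v : 0 <= enorm v.
Proof. exact: sqrtr_ge0. Qed.

Lemma enorm0 : enorm (0 : 'rV[R]_n) = 0.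
Proof.
by rewrite /enorm big1 ?sqrtr0// => i _; rewrite mxE expr0n.
Qed.

Lemma normr_le_enorm v : `|v| <= enorm v.
Proof.
rewrite [leLHS]/Num.norm/= mx_normrE; apply: bigmax_le => [|[i j] _ /=].
  exact: enorm_ge0.
rewrite ord1 -sqrtr_sqr ler_wsqrtr// (bigD1 j)//= lerDl.
by apply: sumr_ge0 => k _; exact: sqr_ge0.
Qed.

Lemma enorm_continuous : continuous (@enorm R n).
Proof.
move=> v; have F : Filter (nbhs v) by exact: _.
apply: (@continuous_comp _ _ _ (fun v : 'rV[R]_n => \sum_(i < n) v 0 i ^+ 2)
  Num.sqrt); last exact: sqrt_continuous.
apply: cvgr_sum => i.
have c : (fun v : 'rV[R]_n => v 0 i) @ v --> v 0 i by exact: coord_continuous.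
exact: (cvgM c c).
Qed.

Lemma weight_continuous_Omega (g : R -> R) :
  {within `[0, +oo[, continuous g} -> continuous (@weight R n g).
Proof.
move=> cg.
have cg0 := continuous_max0 cg.
have -> : weight g = fun z : Omega R n => g (Num.max (enorm z.2) 0).
  by apply/funext => z; rewrite /weight max_l// enorm_ge0.
move=> z; apply: (@continuous_comp _ _ _ (fun z : Omega R n => enorm z.2)
  (fun s : R => g (Num.max s 0))); last exact: cg0.
apply: continuous_comp; [exact: cvg_snd|exact: enorm_continuous].
Qed.

Lemma compact_enorm_le (r : R) :
  compact ([set: torus R n] `*` [set v : 'rV[R]_n | enorm v <= r]).
Proof.
apply: compact_setX; first exact: torus_compact.
apply: bounded_closed_compact.
  exists r; split; first exact: num_real.
  move=> M rM v /= vr; apply: le_trans (normr_le_enorm v) _.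
  by rewrite (le_trans vr)// ltW.
apply: (@closed_comp _ _ (@enorm R n) [set x | x <= r]).
  by move=> v _; exact: enorm_continuous.
exact: closed_le.
Qed.

(** [repr] is not continuous, so continuity is tested on lifts, where periodicity turns [on_Omega L]
    back into [L]. *)
Lemma on_Omega_continuous (L : 'rV[R]_n -> 'rV[R]_n -> R) : lagrangian L ->
  continuous (on_Omega L).
Proof.
move=> hL; apply: Omega_continuous.
have -> : on_Omega L \o @to_Omega R n = fun p => L p.1 p.2.
  apply/funext => -[x v]; rewrite /on_Omega/=.
  exact: (lagrangian_periodic hL v (repr_torus x)).
move=> p; apply: differentiable_continuous.
exact: (lagrangian_smooth hL [::] p).
Qed.

End enorm.

(** * Nonnegative charges and the weak-* topology *)

Section nonnegative_charge.
Context d (T : measurableType d) (R : realType).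
Variable mu : {charge set T -> \bar R}.
Hypothesis mu_ge0 : forall A, measurable A -> (0 <= mu A)%E.

(** On subsets of the negative Hahn set the charge is both nonpositive and nonnegative. Integration
    against a nonnegative charge thus reduces to its positive part, a genuine measure. *)
Lemma jordan_neg_ge0_charge A : measurable A ->
  jordan_neg (hahn_posneg mu) A = 0%E.
Proof.
move=> mA; rewrite jordan_negE cjordan_negE /crestr0 mem_set// /crestr.
have [_ [mN negN] _ _] := hahn_posneg mu.
have mAN : measurable (A `&` hahn_neg mu) by exact: measurableI.
have /eqP -> : mu (A `&` hahn_neg mu) == 0%E.
  by rewrite eq_le mu_ge0// negN.
by rewrite oppe0.
Qed.

Lemma jordan_pos_ge0_charge A : measurable A ->
  jordan_pos (hahn_posneg mu) A = mu A.
Proof.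
move=> mA.
have -> : (mu A = jordan_pos (hahn_posneg mu) A +
    (- (1))%R%:E * jordan_neg (hahn_posneg mu) A)%E.
  exact: jordan_decomp (hahn_posneg mu) A mA.
by rewrite jordan_neg_ge0_charge// mule0 adde0.
Qed.

Lemma charge_integral_ge0_charge (f : T -> R) :
  charge_integral mu f = (\int[jordan_pos (hahn_posneg mu)]_z (f z)%:E)%E.
Proof.
rewrite /charge_integral [X in (_ - X)%E](eq_measure_integral mzero).
  by rewrite integral_measure_zero sube0.
by move=> A mA _; exact: jordan_neg_ge0_charge.
Qed.

Lemma integral_total_variation_ge0_charge (f : T -> \bar R) :
  (\int[Defs.total_variation mu]_z f z =
   \int[jordan_pos (hahn_posneg mu)]_z f z)%E.
Proof.
apply: eq_measure_integral => A mA _.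
transitivity (jordan_pos (hahn_posneg mu) A +
  jordan_neg (hahn_posneg mu) A)%E => //.
by rewrite jordan_neg_ge0_charge// adde0.
Qed.

End nonnegative_charge.

Section charge_of_measure.
Context d (T : measurableType d) (R : realType).
Variable mu : {finite_measure set T -> \bar R}.

Lemma jordan_pos_charge_of_measure (f : T -> \bar R) :
  (\int[jordan_pos (hahn_posneg (charge_of_finite_measure mu))]_z f z =
  \int[mu]_z f z)%E.
Proof.
apply: eq_measure_integral => A mA _.
exact: (@jordan_pos_ge0_charge _ _ _ (charge_of_finite_measure mu)).
Qed.

Lemma charge_integral_charge_of_measure (f : T -> R) :
  charge_integral (charge_of_finite_measure mu) f = (\int[mu]_z (f z)%:E)%E.
Proof.
by rewrite charge_integral_ge0_charge// jordan_pos_charge_of_measure.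
Qed.

End charge_of_measure.

Lemma initial_topology_cvg (S : choiceType) (T : topologicalType) (f : S -> T)
    (F : set_system S) (s : S) : Filter F ->
  f @ F --> f s -> F --> (s : initial_topology f).
Proof.
move=> FF fF A; rewrite nbhsE => -[B [[C oC CB] Bs] BA].
apply: filterS BA _; rewrite -CB; apply: fF.
by apply: open_nbhs_nbhs; split => //; rewrite -CB in Bs.
Qed.

Lemma prod_topology_cvg (I : Type) (T : topologicalType)
    (F : set_system (I -> T)) (f : I -> T) : Filter F ->
  (forall i, (fun h => h i) @ F --> f i) ->
  F --> (f : {ptws I -> T}).
Proof.
move=> FF Ff; apply/cvg_sup => i.
by apply: initial_topology_cvg; exact: Ff.
Qed.

Section weak_star.
Context (R : realType) (n : nat) (g : R -> R).

Lemma weak_star_cvg (F : set_system (Mgamma n g)) (mu : Mgamma n g) :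
  Filter F ->
  (forall phi : C0gamma n g,
    (fun nu : Mgamma n g => pairing nu phi) @ F --> pairing mu phi) ->
  F --> mu.
Proof.
move=> FF cvgF; apply: initial_topology_cvg.
by apply: prod_topology_cvg => phi; exact: cvgF.
Qed.

End weak_star.

(** * Compactness of sublevels of the action *)

Notation borel_measure R n := {measure set (borelOmega R n) -> \bar R}.

Section compactness.
Context (R : realType) (n : nat).
Implicit Types m : borel_measure R n.

(** The truncations [min(H, k)] pass to the limit and monotone convergence removes [k]. With [H] the
    weight this puts the limit in [Mgamma]; with [H] the Lagrangian it is lower semicontinuity of
    the action. *)
Lemma le_integral_weak_limit (J : Type) (U : set_system J)
    (m_ : J -> borel_measure R n) m (H : Omega R n -> R) (B : R) :
  ProperFilter U ->
  (\forall j \near U, m_ j setT = 1%E) -> m setT = 1%E ->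
  (forall f, bounded_continuous f ->
    (fun j => fine (\int[m_ j]_z (f z)%:E)%E) @ U -->
      fine (\int[m]_z (f z)%:E)%E) ->
  continuous H -> (forall z, 0 <= H z) ->
  (\forall j \near U, (\int[m_ j]_z (H z)%:E <= B%:E)%E) ->
  (\int[m]_z (H z)%:E <= B%:E)%E.
Proof.
move=> FU m_1 m1 m_m cH H0 HB.
pose Hk k z := Num.min (H z) k%:R.
have bHk k : bounded_continuous (Hk k) by exact: bounded_continuous_min.
have Hk0 k z : 0 <= Hk k z by rewrite le_min H0 ler0n.
have mH (f : Omega R n -> R) : continuous f -> measurable_fun setT
    (EFin \o f : borelOmega R n -> \bar R).
  move=> cf; apply/measurable_EFinP.
  exact: continuous_borel_measurable.
have mHk k : measurable_fun setT (EFin \o Hk k : borelOmega R n -> \bar R).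
  by apply: mH; have [] := bHk k.
have intHk k : (\int[m]_z (Hk k z)%:E <= B%:E)%E.
  rewrite -[X in (X <= _)%E]fineK; last first.
    exact: bounded_continuous_integral_fin_num.
  rewrite lee_fin; apply: (cvgr_to_le (m_m _ (bHk k))).
  near=> j; rewrite -lee_fin fineK; last first.
    by apply: bounded_continuous_integral_fin_num => //; near: j.
  apply: (@le_trans _ _ (\int[m_ j]_z (H z)%:E)%E); last by near: j.
  apply: ge0_le_integral => //; [| exact: mHk | exact: mH |].
  - by move=> z _; rewrite lee_fin.
  - by move=> z _; rewrite lee_fin /Hk ge_min lexx.
have := @cvg_monotone_convergence _ (borelOmega R n) R m setT measurableT
  (fun k z => (Hk k z)%:E) (fun k => mHk k).
have HkH z : (fun k => (Hk k z)%:E) @ \oo --> (H z)%:E.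
  apply: cvg_near_cst; near=> k; rewrite /Hk min_l//.
  near: k; exact: nbhs_infty_ger.
have -> : (\int[m]_z (H z)%:E = \int[m]_z (limn (fun k => (Hk k z)%:E)))%E.
  by apply: eq_integral => z _; apply/esym/cvg_lim.
move=> /(_ _ _)/cvge_to_le; apply.
- by move=> k z _; rewrite lee_fin.
- move=> z _ k l kl; rewrite lee_fin /Hk le_min !ge_min lexx /=.
  by rewrite ler_nat kl orbT.
- exact: nearW.
Unshelve. all: by end_near. Qed.

Section weighted.
Variable g : R -> R.
Hypothesis cg : {within `[0, +oo[, continuous g}.
Hypothesis g_ge1 : forall s, 0 <= s -> 1 <= g s.

Lemma weight_fun_ge1 (z : Omega R n) : 1 <= weight g z.
Proof. exact/g_ge1/enorm_ge0. Qed.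

Lemma weight_ge0 (z : Omega R n) : 0 <= weight g z.
Proof. by rewrite (le_trans ler01)// weight_fun_ge1. Qed.

Lemma measurable_weight :
  measurable_fun setT ((fun z => (weight g z)%:E) : borelOmega R n -> \bar R).
Proof.
apply/measurable_EFinP; apply: continuous_borel_measurable.
exact: weight_continuous_Omega.
Qed.

(** Take [N] bounding [phi] on the compact set where [enorm v <= r]. Clamping [phi] to [[-N, N]]
    changes nothing there, and elsewhere moves [phi] by at most its absolute value, which is below
    [e * gamma]. *)
Lemma C0gamma_approx (phi : C0gamma n g) (e : R) : 0 < e ->
  exists2 f, bounded_continuous f &
    forall z, `|phi z - f z| <= e * weight g z.
Proof.
move=> e0; have [cphi _ /(_ _ e0)[r phir]] := C0gammaP phi.
pose K := [set: torus R n] `*` [set v : 'rV[R]_n | enorm v <= r].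
(* [bounded_set] provides bounds only by constants strictly above [M], whence [|M| + 1], which is
   also nonnegative. *)
have [M [_ /(_ (`|M| + 1)) phiM]] : bounded_set (phi @` K).
  apply: compact_bounded; apply: continuous_compact.
    exact: continuous_subspaceT.
  exact: compact_enorm_le.
have {}phiM z : K z -> `|phi z| <= `|M| + 1.
  move=> Kz; apply: phiM; last by exists z.
  by rewrite (le_lt_trans (ler_norm _))// ltrDl.
set N := `|M| + 1 in phiM.
have N0 : 0 <= N by rewrite addr_ge0.
exists (fun z => Num.max (Num.min (phi z) N) (- N)).
  split.
    move=> z; apply: (@continuous_max _ _
      (fun z => Num.min (phi z) N) (fun=> - N)).
      apply: (@continuous_min _ _ phi (fun=> N)); first exact: cphi.
      exact: cst_continuous.
    exact: cst_continuous.
  exists N => z; rewrite ler_norml le_max lexx orbT/= ge_max ge_min lexx orbT/=.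
  by rewrite ge0_cp.
move=> z; have [Kz|nKz] := pselect (K z).
  have := phiM z Kz; rewrite ler_norml => /andP[N1 N2].
  by rewrite min_l// max_l// subrr normr0 mulr_ge0// ?weight_ge0// ltW.
have rz : r < enorm z.2.
  by rewrite ltNge; apply/negP => rz; apply: nKz.
have := phir z rz; rewrite normrM normfV (ger0_norm (weight_ge0 z)).
rewrite ltr_pdivrMr; last exact: lt_le_trans (weight_fun_ge1 z).
move=> /ltW; apply: le_trans.
have [h1|h1] := leP (phi z) N; have := N0.
  have [h2|h2] := leP (phi z) (- N).
    by rewrite opprK; have := ler_norm (- phi z); rewrite normrN;
       case: (ger0P (phi z)); case: (ger0P (phi z + N)); lra.
  by rewrite subrr normr0.
rewrite max_l; last by lra.
by case: (ger0P (phi z)); case: (ger0P (phi z - N)); lra.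
Qed.

Lemma C0gamma_integrable m (phi : C0gamma n g) :
  (\int[m]_z (weight g z)%:E < +oo)%E ->
  m.-integrable setT (EFin \o phi : borelOmega R n -> \bar R).
Proof.
move=> mg; have [cphi [C phiC] _] := C0gammaP phi.
apply/integrableP; split.
  by apply/measurable_EFinP; exact: continuous_borel_measurable.
apply: (@le_lt_trans _ _ (\int[m]_z (`|C|%:E * (weight g z)%:E))%E).
  apply: ge0_le_integral => //.
  - apply: measurableT_comp => //.
    by apply/measurable_EFinP; exact: continuous_borel_measurable.
  - exact: measurable_funeM measurable_weight.
  - move=> z _; rewrite /= lee_fin.
    have := phiC z; rewrite normrM normfV (ger0_norm (weight_ge0 z)).
    rewrite ler_pdivrMr; last exact: lt_le_trans (weight_fun_ge1 z).
    move=> /le_trans; apply.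
    by rewrite ler_wpM2r ?weight_ge0// ler_norm.
rewrite ge0_integralZl//.
- by rewrite lte_mul_pinfty// lee_fin.
- exact: measurable_weight.
- by move=> z _; rewrite lee_fin weight_ge0.
Qed.

Lemma C0gamma_integral_approx m (phi : C0gamma n g) f (e B : R) :
  m setT = 1%E -> (\int[m]_z (weight g z)%:E <= B%:E)%E ->
  bounded_continuous f -> 0 <= e ->
  (forall z, `|phi z - f z| <= e * weight g z) ->
  `|fine (\int[m]_z (phi z)%:E)%E - fine (\int[m]_z (f z)%:E)%E| <= e * B.
Proof.
move=> m1 mB bf e0 phif; have [cphi _ _] := C0gammaP phi.
have iphi : m.-integrable setT (EFin \o phi : borelOmega R n -> \bar R).
  by apply: C0gamma_integrable; exact: le_lt_trans (ltry B).
have i_f := bounded_continuous_integrable m1 bf.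
have ib : m.-integrable setT
    ((fun z => (phi z)%:E - (f z)%:E)%E : borelOmega R n -> \bar R).
  exact: integrableB.
rewrite -fineB; [|exact: integrable_fin_num iphi|exact: integrable_fin_num i_f].
rewrite -integralB_EFin// -lee_fin -abse_EFin fineK; last first.
  exact: integrable_fin_num ib.
apply: (le_trans (le_abse_integral _ _ _)) => //.
  exact: measurable_int ib.
apply: (@le_trans _ _ (\int[m]_z (e%:E * (weight g z)%:E))%E).
  apply: ge0_le_integral => //.
  - by apply: measurableT_comp => //; exact: measurable_int ib.
  - exact: measurable_funeM measurable_weight.
  - by move=> z _; rewrite /= lee_fin.
rewrite ge0_integralZl//.
- by rewrite EFinM lee_wpmul2l// lee_fin.
- exact: measurable_weight.
- by move=> z _; rewrite lee_fin weight_ge0.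
Qed.

End weighted.

End compactness.

Lemma distr_le3 (R : realType) (a b c d x y z : R) :
  `|a - b| <= x -> `|d - c| <= y -> `|b - c| <= z -> `|a - d| <= x + y + z.
Proof.
rewrite !ler_norml => /andP[? ?] /andP[? ?] /andP[? ?].
by apply/andP; split; lra.
Qed.

Lemma third_add (R : realType) (e : R) : e / 3 + e / 3 + e / 3 = e.
Proof. lra. Qed.

Section M1_compactness.
Context (R : realType) (n : nat).
Variables (L : 'rV[R]_n -> 'rV[R]_n -> R) (g : R -> R).
Hypotheses (hL : lagrangian L) (hg : admissible_weight L g).

Let cg := weight_continuous hg.
Let g_ge1 := weight_ge1 hg.

(** Defined on all of [Mgamma], so that it can be used along a filter on which [M1] holds only
    eventually; on [M1] it agrees with the charge. *)
Definition Mmeasure (mu : Mgamma n g) : borel_measure R n :=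
  jordan_pos (hahn_posneg mu).

Lemma MmeasureT mu : M1 n g mu -> Mmeasure mu setT = 1%E.
Proof.
by move=> [mu0 mu1]; exact: etrans (jordan_pos_ge0_charge mu0 measurableT) mu1.
Qed.

Lemma M1_charge_integral mu (f : Omega R n -> R) : M1 n g mu ->
  charge_integral mu f = (\int[Mmeasure mu]_z (f z)%:E)%E.
Proof. by move=> [mu0 _]; rewrite charge_integral_ge0_charge. Qed.

Lemma action_ge0 mu : M1 n g mu -> (0 <= action L g mu)%E.
Proof.
move=> mu1; rewrite /action M1_charge_integral//.
by apply: integral_ge0 => z _; rewrite lee_fin (lagrangian_ge0 hL).
Qed.

Lemma M1_of_measure (m : borel_measure R n) (B : R) :
  m setT = 1%E -> (\int[m]_z (weight g z)%:E <= B%:E)%E ->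
  exists2 mu : Mgamma n g, M1 n g mu &
    forall f : Omega R n -> R,
      charge_integral mu f = (\int[m]_z (f z)%:E)%E.
Proof.
move=> m1 mB.
have mT : (m setT < +oo)%E by rewrite m1 ltry.
(* Restriction to the whole space leaves [m] unchanged and packs it with its finiteness. *)
pose m' : {finite_measure set (borelOmega R n) -> \bar R} :=
  mfrestr measurableT mT.
have m'E (f : Omega R n -> R) : (\int[m']_z (f z)%:E = \int[m]_z (f z)%:E)%E.
  by apply: eq_measure_integral => A _ _; rewrite -[in RHS](setIT A).
have mM : in_Mgamma g (charge_of_finite_measure m').
  rewrite /in_Mgamma integral_total_variation_ge0_charge; last first.
    by move=> A _; exact: measure_ge0.
  by rewrite jordan_pos_charge_of_measure m'E; exact: le_lt_trans (ltry B).
exists (MGamma mM).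
  split=> [A _|]; first exact: measure_ge0.
  by rewrite -m1 -[in RHS](setIT setT).
by move=> f; rewrite charge_integral_charge_of_measure.
Qed.

(** Beyond some radius [L / gamma > 1], and on the remaining compact set [gamma] is bounded. A bound
    on the action thus bounds the integral of [gamma]. *)
Lemma weight_le_lagrangian : exists2 B : R, 0 <= B &
  forall z : Omega R n, weight g z <= B + on_Omega L z.
Proof.
have [r Lr] := weight_lagrangian hg 1.
have [M [_ /(_ (`|M| + 1)) gM]] : bounded_set (weight g @`
    ([set: torus R n] `*` [set v : 'rV[R]_n | enorm v <= r])).
  apply: compact_bounded; apply: continuous_compact.
    by apply: continuous_subspaceT; exact: weight_continuous_Omega.
  exact: compact_enorm_le.
exists (`|M| + 1) => [|z]; first by rewrite addr_ge0.
have [zr|zr] := leP (enorm z.2) r.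
  apply: (@le_trans _ _ (`|M| + 1)); last by rewrite lerDl (lagrangian_ge0 hL).
  apply: le_trans (ler_norm _) (gM _ _ _); last by exists z.
  by rewrite (le_lt_trans (ler_norm _))// ltrDl.
have := Lr (repr z.1) z.2 zr; rewrite ltr_pdivlMr ?mul1r; last first.
  by rewrite (lt_le_trans ltr01)// g_ge1// enorm_ge0.
move=> /ltW /le_trans; apply.
by rewrite lerDr addr_ge0.
Qed.

(** Markov's inequality: outside [K] coercivity gives [L > A], so [f <= L / A] everywhere. *)
Lemma lagrangian_tight (e C : R) : 0 < e -> 0 <= C ->
  exists2 K : set (Omega R n), compact K &
    forall f, bounded_continuous f -> (forall z, 0 <= f z <= 1) ->
      (forall z, K z -> f z = 0) ->
      forall m : borel_measure R n, m setT = 1%E ->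
      (\int[m]_z (on_Omega L z)%:E <= C%:E)%E ->
      fine (\int[m]_z (f z)%:E)%E <= e.
Proof.
(* [C / A <= e] is what is needed; [C + 1] keeps [A] positive when [C = 0]. *)
move=> e0 C0; pose A := (C + 1) / e.
have A0 : 0 < A by rewrite divr_gt0// ltr_wpDl.
have [r Lr] := lagrangian_coercive hL A.
exists ([set: torus R n] `*` [set v : 'rV[R]_n | enorm v <= r]).
  exact: compact_enorm_le.
move=> f bf f01 fK m m1 mC.
rewrite -lee_fin fineK; last exact: bounded_continuous_integral_fin_num.
apply: (@le_trans _ _ (\int[m]_z (A^-1%:E * (on_Omega L z)%:E))%E).
  apply: ge0_le_integral => //.
  - by move=> z _; rewrite lee_fin; have /andP[] := f01 z.
  - apply/measurable_EFinP; apply: continuous_borel_measurable.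
    by have [] := bf.
  - apply: measurable_funeM; apply/measurable_EFinP.
    by apply: continuous_borel_measurable; exact: on_Omega_continuous.
  move=> z _; rewrite -EFinM lee_fin.
  have [zr|zr] := leP (enorm z.2) r.
    rewrite fK//; rewrite mulr_ge0 ?invr_ge0 ?(ltW A0)//.
    exact: lagrangian_ge0 hL _ _.
  have /andP[_ fz1] := f01 z; apply: (le_trans fz1).
  by rewrite mulrC ler_pdivlMr// mul1r ltW// Lr.
rewrite ge0_integralZl//; last 3 first.
- apply/measurable_EFinP; apply: continuous_borel_measurable.
  exact: on_Omega_continuous.
- by move=> z _; rewrite lee_fin (lagrangian_ge0 hL).
- by rewrite lee_fin invr_ge0 ltW.
apply: (@le_trans _ _ (A^-1%:E * C%:E)%E).
  by rewrite lee_wpmul2l// lee_fin invr_ge0 ltW.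
rewrite -EFinM lee_fin /A invf_div mulrAC ler_pdivrMr ?ltr_wpDl//.
by rewrite ler_pM2l// lerDl.
Qed.

(** The index type is arbitrary because the theorem serves twice: for a minimizing sequence and for
    the occupation measures indexed by the time [T]. Lower semicontinuity takes the form that every
    eventual bound on the action survives in the limit. *)
Theorem M1_sublevel_compact (J : Type) (U : set_system J)
    (nu : J -> Mgamma n g) (C : R) : UltraFilter U ->
  (\forall j \near U, M1 n g (nu j) /\ (action L g (nu j) <= C%:E)%E) ->
  exists mu : Mgamma n g,
    [/\ nu @ U --> mu, M1 n g mu & forall B : R,
      (\forall j \near U, (action L g (nu j) <= B%:E)%E) ->
      (action L g mu <= B%:E)%E].
Proof.
move=> UU nuC; have FU := @ultra_proper _ _ UU.
have C0 : 0 <= C.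
  have [j [nu1 nuC']] := filter_ex nuC.
  by rewrite -lee_fin; exact: le_trans (action_ge0 nu1) nuC'.
have nu1 : \forall j \near U, Mmeasure (nu j) setT = 1%E.
  by apply: filterS nuC => j [nu1 _]; exact: MmeasureT.
have nuL : \forall j \near U,
    (\int[Mmeasure (nu j)]_z (on_Omega L z)%:E <= C%:E)%E.
  by apply: filterS nuC => j [nu1' ?]; rewrite -M1_charge_integral.
have [|m [m1 num]] := @prokhorov R (Omega R n) J U UU (Mmeasure \o nu)
    (@Omega_openP R n) nu1.
  move=> e e0; have [K cK tK] := lagrangian_tight e0 C0.
  exists K => // f bf f01 fK.
  by apply: filterS2 nu1 nuL => j nu1' nuL'; exact: tK.
have [B B0 gB] := weight_le_lagrangian.
have cL : continuous (on_Omega L) by exact: on_Omega_continuous.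
have mL : measurable_fun setT
    ((fun z => (on_Omega L z)%:E) : borelOmega R n -> \bar R).
  by apply/measurable_EFinP; exact: continuous_borel_measurable.
have nug : \forall j \near U,
    (\int[Mmeasure (nu j)]_z (weight g z)%:E <= (B + C)%:E)%E.
  apply: filterS2 nu1 nuL => j nu1' nuL'.
  apply: (@le_trans _ _ (\int[Mmeasure (nu j)]_z
      (B%:E + (on_Omega L z)%:E))%E).
    apply: ge0_le_integral => //.
    - by move=> z _; rewrite lee_fin weight_ge0.
    - exact: measurable_weight.
    - exact: emeasurable_funD.
    - by move=> z _; rewrite -EFinD lee_fin.
  rewrite ge0_integralD//; last first.
    by move=> z _; rewrite lee_fin (lagrangian_ge0 hL).
  by rewrite (probability_integral_cst nu1') EFinD leeD2l.
have mg : (\int[m]_z (weight g z)%:E <= (B + C)%:E)%E.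
  apply: (le_integral_weak_limit FU nu1 m1 num) => //.
    exact: weight_continuous_Omega.
  by move=> z; exact: weight_ge0.
have [mu mu1 muE] := M1_of_measure m1 mg.
exists mu; split => //; last first.
  move=> b nub; rewrite /action muE.
  apply: (le_integral_weak_limit FU nu1 m1 num) => //.
    by move=> z; exact: lagrangian_ge0 hL _ _.
  apply: filterS2 nuC nub => j [nuj _].
  by rewrite /action M1_charge_integral.
apply: weak_star_cvg => phi.
suff : (fun j => pairing (nu j) phi) @ U --> pairing mu phi by [].
rewrite /pairing muE; apply/cvgrPdist_le => e e0.
(* A positive upper bound of [B + C], so that [d = e / (3 * B')] makes sense and each replacement of
   [phi] by [f] costs at most [e / 3]. *)
pose B' := `|B + C| + 1.
have B'0 : 0 < B' by rewrite ltr_wpDl.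
pose d := e / (3 * B').
have d0 : 0 < d by rewrite divr_gt0// mulr_gt0.
have dB : d * (B + C) <= e / 3.
  apply: (@le_trans _ _ (d * B')).
    by rewrite ler_pM2l// /B' (le_trans (ler_norm _))// lerDl.
  rewrite /d invfM mulrA -mulrA mulVf ?mulr1// gt_eqF//.
have [f bf phif] := C0gamma_approx g_ge1 phi d0.
have e3 : 0 < e / 3 by rewrite divr_gt0.
have := num f bf => /cvgrPdist_le /(_ _ e3) numf.
near=> j.
have nuj1 : M1 n g (nu j) by near: j; apply: filterS nuC => j [].
rewrite M1_charge_integral//.
have h1 := C0gamma_integral_approx cg g_ge1 m1 mg bf (ltW d0) phif.
have h2 : `|fine (\int[Mmeasure (nu j)]_z (phi z)%:E)%E -
    fine (\int[Mmeasure (nu j)]_z (f z)%:E)%E| <= d * (B + C).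
  apply: (C0gamma_integral_approx cg g_ge1 _ _ bf (ltW d0) phif).
    by near: j.
  by near: j.
have h3 : `|fine (\int[m]_z (f z)%:E)%E -
    fine (\int[Mmeasure (nu j)]_z (f z)%:E)%E| <= e / 3 by near: j.
apply: le_trans (distr_le3 h1 h2 h3) _.
by rewrite -[leRHS](third_add e) lerD// lerD.
Unshelve. all: by end_near. Qed.

End M1_compactness.

(** * The uncontrolled process *)

Lemma ltr_dist_floor (R : realType) k (t : R) :
  `|t - (Num.floor (t * k.+1%:R))%:~R / k.+1%:R| < k.+1%:R^-1.
Proof.
have k0 : 0 < k.+1%:R :> R by [].
rewrite -{1}[t](mulfK (lt0r_neq0 k0)) -mulrBl normrM [X in _ * X]ger0_norm//.
rewrite -[ltRHS]mul1r ltr_pM2r ?invr_gt0//.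
have /andP[fl1 fl2] := floor_itv (t * k.+1%:R).
rewrite ger0_norm ?subr_ge0// ltrBlDr addrC.
by move: fl2; rewrite intrD.
Qed.

Lemma measurable_floor_fiber (R : realType) k m :
  measurable [set t : measurableTypeR R | Num.floor (t * k.+1%:R) = m].
Proof.
have -> : [set t : measurableTypeR R | Num.floor (t * k.+1%:R) = m] =
    `[m%:~R / k.+1%:R, (m + 1)%:~R / k.+1%:R[%classic.
  apply/seteqP; split => t /=.
    move/eqP; rewrite floor_eq in_itv/=.
    by rewrite ler_pdivrMr// ltr_pdivlMr.
  rewrite in_itv/= ler_pdivrMr// ltr_pdivlMr// => mt.
  by apply/eqP; rewrite floor_eq.
exact: measurable_itv.
Qed.

Section measurability.
Context d (Z : measurableType d) (R : realType).

(** [V] is the union of the countably many sup-norm balls contained in it with rational centre and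
    radius [1 / (k + 1)]; the preimage of such a ball is a finite intersection of conditions on
    coordinates. *)
Lemma measurable_preimage_open_rV n (Y : Z -> 'rV[R]_n) (V : set 'rV[R]_n) :
  (forall i, measurable_fun setT (fun z => Y z 0 i)) -> open V ->
  measurable (Y @^-1` V).
Proof.
move=> mY oV.
pose c (p : 'rV[rat]_n * nat) : set 'rV[R]_n :=
  ball (\row_i ratr (p.1 0 i) : 'rV[R]_n) p.2.+1%:R^-1.
have -> : Y @^-1` V =
    \bigcup_p (if `[< c p `<=` V >] then Y @^-1` c p else set0).
  apply/seteqP; split => [z Vz|z [p _]]; last first.
    by case: asboolP => //= cV; exact: cV.
  have /nbhs_ballP[e e0 eV] := open_nbhs_nbhs (conj oV Vz).
  have [k ke] : exists k : nat, k.+1%:R^-1 + k.+1%:R^-1 < e :> R.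
    exists (Num.truncn (2 / e)).
    rewrite -[X in X + X]mul1r -mulrDl -[1 + 1]/2 ltr_pdivrMr// mulrC.
    by rewrite -ltr_pdivrMr// truncnS_gt.
  have k0 : 0 < k.+1%:R^-1 :> R by rewrite invr_gt0.
  have [q qz] : {q : 'I_n -> rat & forall i,
      ball (ratr (q i) : R) k.+1%:R^-1 (Y z 0 i)}.
    apply: (@choice _ _ (fun i (q : rat) =>
      ball (ratr q : R) k.+1%:R^-1 (Y z 0 i))) => i.
    have YY : Y z 0 i - k.+1%:R^-1 < Y z 0 i + k.+1%:R^-1.
      by rewrite ltrBlDr -addrA ltrDl addr_gt0.
    have [q] := rat_in_itvoo YY.
    by rewrite in_itv/= -ltr_distl => qY; exists q; rewrite -ball_normE.
  have cYz : c (\row_i q i, k) (Y z).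
    by split => // i j; rewrite ord1 !mxE; exact: qz.
  exists (\row_i q i, k) => //; rewrite asboolT// => x cx; apply: eV.
  apply: (@le_ball _ _ _ (k.+1%:R^-1 + k.+1%:R^-1)); first exact: ltW.
  by apply: ball_triangle cx; exact: ball_sym.
apply: countable_bigcupT_measurable => [|p]; first exact: countableP.
case: asboolP => [cV|_]; last exact: measurable0.
have -> : Y @^-1` c p = \bigcap_(i in [set: 'I_n])
    [set z | ball (ratr (p.1 0 i) : R) p.2.+1%:R^-1 (Y z 0 i)].
  apply/seteqP; split => [z [_ Yz] i _|z Yz]; last split => // i j.
    by have := Yz 0 i; rewrite /= mxE.
  by rewrite ord1 mxE; exact: Yz.
apply: fin_bigcap_measurable => // i _.
rewrite -[X in measurable X]setTI; apply: mY => //.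
by apply: open_measurable; exact: ball_open.
Qed.

(** Freezing the time at the grid point of mesh [1 / (k + 1)] just below it gives countably many
    measurable pieces, and path continuity gives pointwise convergence as [k] grows. *)
Lemma measurable_continuous_process (Y : R -> Z -> R) :
  (forall z, continuous (Y ^~ z)) -> (forall t, measurable_fun setT (Y t)) ->
  measurable_fun setT (fun p : Z * measurableTypeR R => Y p.2 p.1).
Proof.
move=> cY mY.
pose t_ k (t : R) : R := (Num.floor (t * k.+1%:R))%:~R / k.+1%:R.
apply: (@measurable_fun_cvg _ _ _ setT (fun k p => Y (t_ k p.2) p.1)).
- move=> k _ B mB; rewrite setTI.
  have -> : (fun p : Z * measurableTypeR R => Y (t_ k p.2) p.1) @^-1` B =
      \bigcup_(m : int) ((Y (m%:~R / k.+1%:R) @^-1` B) `*`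
        [set t : measurableTypeR R | Num.floor (t * k.+1%:R) = m]).
    apply/seteqP; split => [[z t] /= YB|[z t] [m _ [/= YB mE]]].
      by exists (Num.floor (t * k.+1%:R)).
    by rewrite /t_ mE.
  apply: countable_bigcupT_measurable => [|m]; first exact: countableP.
  apply: measurableX.
    by rewrite -[X in measurable X]setTI; exact: mY.
  exact: measurable_floor_fiber.
- move=> [z t] _ /=.
  suff tt : (fun k => t_ k t) @ \oo --> t.
    by apply: (cvg_comp (fun k => t_ k t) (Y ^~ z) tt); exact: cY.
  apply/cvgrPdist_lt => e e0; near=> k.
  apply: (@lt_trans _ _ k.+1%:R^-1); last first.
    near: k; exact: near_infty_natSinv_lt (PosNum e0).
  exact: ltr_dist_floor.
Unshelve. all: by end_near. Qed.

End measurability.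

Section uniform_average.
Context d (W : measurableType d) (R : realType) (P : probability W R).
Context (T : R) (T0 : 0 < T).

Let uT : probability (measurableTypeR R) R := uniform_prob T0.

(** The average over [[0, T]] followed by the expectation becomes one integral against a
    probability, so that [mu_T] is an image measure. *)
Definition uniform_average : set (W * measurableTypeR R) -> \bar R :=
  (P \x uT)%E.

HB.instance Definition _ := Measure.on uniform_average.

Lemma uniform_averageT : uniform_average setT = 1%E.
Proof.
rewrite /uniform_average -setXTT product_measure1E//=.
rewrite [X in (X * _)%E]probability_setT [X in (_ * X)%E]probability_setT.
by rewrite mule1.
Qed.

Lemma bounded_uniform_average_integrable (f : W * measurableTypeR R -> R) M :
  measurable_fun setT f -> (forall z, `|f z| <= M) ->
  uniform_average.-integrable setT (EFin \o f).
Proof.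
move=> mf fM; apply: measurable_bounded_integrable => //.
- by rewrite [ltLHS]uniform_averageT ltry.
- exists M; split; first exact: num_real.
  by move=> N MN x _ /=; rewrite (le_trans (fM x))// ltW.
Qed.

Lemma integral_uniform_average_cst (c : R) :
  (\int[uniform_average]_z c%:E = c%:E)%E.
Proof. by rewrite (integral_cst _ _ c%:E)//= uniform_averageT mule1. Qed.

Lemma integral_uniform_average_le (f : W * measurableTypeR R -> R) M :
  measurable_fun setT f -> (forall z, 0 <= f z <= M) ->
  (\int[uniform_average]_z (f z)%:E <= M%:E)%E.
Proof.
move=> mf fM; rewrite -[leRHS]integral_uniform_average_cst.
apply: ge0_le_integral => //.
- by move=> z _; rewrite lee_fin; have /andP[] := fM z.
- exact/measurable_EFinP.
- by move=> z _; rewrite lee_fin; have /andP[] := fM z.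
Qed.

Lemma uniform_average_dist_le (f h : W * measurableTypeR R -> R) M N e :
  measurable_fun setT f -> (forall z, `|f z| <= M) ->
  measurable_fun setT h -> (forall z, `|h z| <= N) ->
  (forall z, `|f z - h z| <= e) ->
  `|fine (\int[uniform_average]_z (f z)%:E)%E -
    fine (\int[uniform_average]_z (h z)%:E)%E| <= e.
Proof.
move=> mf fM mh hN fh.
have i_f := bounded_uniform_average_integrable mf fM.
have ih := bounded_uniform_average_integrable mh hN.
rewrite -fineB; [|exact: integrable_fin_num i_f|exact: integrable_fin_num ih].
rewrite -integralB_EFin//.
have ifh : uniform_average.-integrable setT (fun z => ((f z)%:E - (h z)%:E)%E).
  exact: integrableB.
rewrite -lee_fin -abse_EFin fineK; last exact: integrable_fin_num ifh.
apply: (le_trans (le_abse_integral _ _ _)) => //.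
  exact: measurable_int ifh.
rewrite -[leRHS]integral_uniform_average_cst.
apply: ge0_le_integral => //.
- by apply: measurableT_comp => //; exact: measurable_int ifh.
- by move=> z _; rewrite /= lee_fin.
Qed.

(** The identity holds for nonnegative functions; boundedness makes the negative part finite, so
    that the two parts may be subtracted. *)
Lemma integral_uniform_bounded (f : measurableTypeR R -> R) M :
  measurable_fun setT f -> (forall t, `|f t| <= M) ->
  (\int[lebesgue_measure]_(t in `[0%R, T]) (f t)%:E =
   T%:E * \int[uT]_t (f t)%:E)%E.
Proof.
move=> mf fM.
have mEf : measurable_fun setT (EFin \o f) by exact/measurable_EFinP.
have T1 : (T%:E * (T - 0)^-1%:E = 1)%E.
  by rewrite subr0 -EFinM divff// gt_eqF.
have H (h : measurableTypeR R -> \bar R) : measurable_fun setT h ->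
    (forall t, (0 <= h t)%E) ->
    (\int[lebesgue_measure]_(t in `[0%R, T]) h t = T%:E * \int[uT]_t h t)%E.
  by move=> mh h0; rewrite integral_uniform// muleA T1 mul1e.
have iuf : uT.-integrable setT (EFin \o f).
  apply: measurable_bounded_integrable => //.
    by rewrite [ltLHS]probability_setT ltry.
  exists M; split; first exact: num_real.
  by move=> N MN x _ /=; rewrite (le_trans (fM x))// ltW.
rewrite integralE [X in (_ = _ * X)%E]integralE.
rewrite !H//; last 2 first.
- exact: measurable_funeneg.
- exact: measurable_funepos.
have TB (a b : \bar R) : b \is a fin_num ->
    (T%:E * (a - b) = T%:E * a - T%:E * b)%E.
  by move=> bfin; rewrite muleBr// fin_num_adde_defl// fin_numN.
by rewrite [RHS]TB//; exact: integrable_neg_fin_num iuf.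
Qed.

Lemma uniform_averageE (f : W * measurableTypeR R -> R) M :
  measurable_fun setT f -> (forall z, `|f z| <= M) ->
  (\int[uniform_average]_z (f z)%:E =
   T^-1%:E * \int[P]_om \int[lebesgue_measure]_(t in `[0%R, T])
     (f (om, t))%:E)%E.
Proof.
move=> mf fM.
have imf := bounded_uniform_average_integrable mf fM.
have mfx om : measurable_fun setT (fun t : measurableTypeR R => f (om, t)).
  exact: measurableT_comp (measurable_pair1 om).
under [X in (_ * X)%E]eq_integral do
  rewrite (integral_uniform_bounded (mfx _) (fun t => fM (_, t))).
rewrite integralZl//; last exact: (integrable_fubini_F imf).
rewrite muleA -EFinM mulVf ?gt_eqF// mul1e.
exact/esym/(integral12_prod_meas1 imf).
Qed.

End uniform_average.

Section image_probability.
Context d (X : measurableType d) (R : realType) (n : nat).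
Variables (m : {measure set X -> \bar R}) (m1 : m setT = 1%E).
Variables (phi : X -> borelOmega R n) (mphi : measurable_fun setT phi).

Lemma image_probability : exists m' : borel_measure R n,
  m' setT = 1%E /\
  (forall f : Omega R n -> R, continuous f ->
      m.-integrable setT (EFin \o (f \o phi)) ->
      (\int[m']_z (f z)%:E = \int[m]_x (f (phi x))%:E)%E).
Proof.
have mf (f : Omega R n -> R) : continuous f ->
    measurable_fun setT (EFin \o f : borelOmega R n -> \bar R).
  by move=> cf; apply/measurable_EFinP; exact: continuous_borel_measurable.
exists (pushforward m phi); split.
- exact: m1.
- move=> f cf fi.
  exact: (@integral_pushforward _ _ _ _ _ phi mphi m setT (EFin \o f)
    (mf f cf) fi measurableT).
Unshelve. exact: mphi.
Qed.

End image_probability.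

Section zero_control.
Context (R : realType) (n : nat) (sigma : R).
Context d (W : measurableType d) (P : probability W R).
Variables (F : R -> set_system W) (hF : filtration F).
Variables (w : R -> W -> 'rV[R]_n) (hw : brownian_motion P F w).

(* [Num.max p.2 0] extends the process by its initial value to negative times,
   where nothing is known about [w]. *)
Definition lifted_process (p : W * measurableTypeR R) : 'rV[R]_n :=
  sigma *: w (Num.max p.2 0) p.1.

Definition Omega_process (p : W * measurableTypeR R) : borelOmega R n :=
  to_Omega (lifted_process p, 0).

Let w_coord_measurable t i : 0 <= t ->
  measurable_fun setT (fun om => w t om 0 i).
Proof.
move=> t0; have [_ _ mw _] := hw; have [sF Fm _] := hF.
move=> _ B mB; rewrite setTI; apply: (Fm t t0).
have := mw t i t0 measurableT B mB; rewrite setTI.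
by rewrite measurable_g_measurableTypeE//; exact: sF.
Qed.

Let w_continuous om : continuous (fun t : R => w (Num.max t 0) om).
Proof.
have [_ cw _ _] := hw.
by apply: (continuous_max0 (f := w ^~ om)); exact: cw.
Qed.

Lemma lifted_process_measurable i :
  measurable_fun setT (fun p => lifted_process p 0 i).
Proof.
apply: (@measurable_continuous_process _ W R
  (fun (t : R) om => (sigma *: w (Num.max t 0) om) 0 i)).
  move=> om t.
  have -> : (fun t : R => (sigma *: w (Num.max t 0) om) 0 i) =
      (fun t : R => sigma * w (Num.max t 0) om 0 i).
    by apply/funext => s; rewrite mxE.
  have c : (fun t : R => w (Num.max t 0) om 0 i) @ t --> w (Num.max t 0) om 0 i.
    have cc : {for w (Num.max t 0) om, continuous (fun v : 'rV[R]_n => v 0 i)}.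
      exact: coord_continuous.
    exact: (continuous_comp (@w_continuous om t) cc).
  exact: cvgM (cvg_cst _) c.
move=> t; under eq_fun do rewrite mxE.
apply: measurable_funM; first exact: measurable_cst.
by apply: w_coord_measurable; rewrite le_max lexx orbT.
Qed.

Lemma Omega_process_measurable : measurable_fun setT Omega_process.
Proof.
apply: (@measurability _ _ _ (borelOmega R n) setT Omega_process
  (@open (Omega R n))) => //.
move=> _ [U oU <-]; rewrite setTI.
have -> : Omega_process @^-1` U =
    lifted_process @^-1` ((fun x : 'rV[R]_n => to_Omega (x, 0)) @^-1` U) by [].
apply: measurable_preimage_open_rV; first exact: lifted_process_measurable.
by apply: open_comp => // x _; exact: zero_section_continuous.
Qed.

Lemma zero_control_bounded :
  bounded_control F (fun (_ : R) (_ : W) => 0 : 'rV[R]_n).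
Proof.
split; last by exists 0 => t om _; rewrite enorm0.
move=> t i t0.
rewrite (_ : (fun _ => _) = cst 0); first exact: measurable_cst.
by apply/funext => p; rewrite mxE.
Qed.

Lemma zero_control_trajectory t om : 0 <= t ->
  trajectory sigma w (fun _ _ => 0) 0 t om = lifted_process (om, t).
Proof.
move=> t0; apply/rowP => i.
rewrite /trajectory /lifted_process !mxE/= max_l// add0r.
by rewrite /Rintegral integral0 add0r.
Qed.

End zero_control.

Section zero_control_occupation.
Context (R : realType) (n : nat) (sigma : R).
Variables (L : 'rV[R]_n -> 'rV[R]_n -> R) (g : R -> R).
Hypotheses (hL : lagrangian L) (hg : admissible_weight L g).
Context d (W : measurableType d) (P : probability W R).
Variables (F : R -> set_system W) (hF : filtration F).
Variables (w : R -> W -> 'rV[R]_n) (hw : brownian_motion P F w).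

(** The condition [enorm v <= 0] cuts out a compact set containing the zero section. Weight,
    Lagrangian and test functions are therefore bounded along the uncontrolled process, uniformly in
    time. *)
Lemma zero_section_bounded (f : Omega R n -> R) : continuous f ->
  exists M, forall x, `|f (to_Omega (x, 0))| <= M.
Proof.
move=> cf.
have [M [_ /(_ (`|M| + 1)) fM]] : bounded_set (f @`
    ([set: torus R n] `*` [set v : 'rV[R]_n | enorm v <= 0])).
  apply: compact_bounded; apply: continuous_compact.
    exact: continuous_subspaceT.
  exact: compact_enorm_le.
exists (`|M| + 1) => x; apply: fM.
  by rewrite (le_lt_trans (ler_norm _))// ltrDl.
by exists (to_Omega (x, 0)) => //; split => //=; rewrite enorm0.
Qed.

Lemma Omega_process_comp_measurable (f : Omega R n -> R) : continuous f ->
  measurable_fun setT (fun p => f (Omega_process sigma w p)).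
Proof.
move=> cf; apply: (@measurableT_comp _ _ _ _ _ _ (f : borelOmega R n -> R)).
  exact: continuous_borel_measurable.
exact: (Omega_process_measurable sigma hF hw).
Qed.

(** The last clause admits every continuous [f], so that it also covers [on_Omega L], which need not
    lie in [C0gamma]. *)
Lemma zero_control_occupation T (T0 : 0 < T) : exists mu : Mgamma n g,
  [/\ M1 n g mu, occupation_measure sigma P w (fun _ _ => 0) 0 T mu
    & forall f : Omega R n -> R, continuous f ->
      (charge_integral mu f =
       \int[uniform_average P T0]_p (f (Omega_process sigma w p))%:E)%E].
Proof.
have [m [m1 mE]] := image_probability (uniform_averageT P T0)
  (Omega_process_measurable sigma hF hw).
have mf (f : Omega R n -> R) : continuous f -> (\int[m]_z (f z)%:E =
    \int[uniform_average P T0]_p (f (Omega_process sigma w p))%:E)%E.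
  move=> cf; apply: mE => //.
  have [M fM] := zero_section_bounded cf.
  exact: (bounded_uniform_average_integrable P T0
    (Omega_process_comp_measurable cf)
    (fun p => fM (lifted_process sigma w p))).
have cw : continuous (@weight R n g).
  exact/weight_continuous_Omega/(weight_continuous hg).
have [B gB] := zero_section_bounded cw.
have mB : (\int[m]_z (weight g z)%:E <= B%:E)%E.
  rewrite mf//; apply: integral_uniform_average_le.
    exact: Omega_process_comp_measurable.
  move=> p; rewrite weight_ge0/=; last exact: weight_ge1 hg.
  exact: le_trans (ler_norm _) (gB _).
have [mu mu1 muE] := M1_of_measure m1 mB.
exists mu; split => //; last by move=> f cf; rewrite muE mf.
move=> phi; have [cphi _ _] := C0gammaP phi.
have [M phiM] := zero_section_bounded cphi.
rewrite muE mf// (uniform_averageE P T0 (Omega_process_comp_measurable cphi)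
  (fun p => phiM (lifted_process sigma w p))).
congr (_ * _)%E; apply: eq_integral => om _; apply: eq_integral => t.
rewrite inE/= in_itv/= => /andP[t0 _].
by rewrite zero_control_trajectory.
Qed.

Lemma zero_control_action_bounded : exists C : R, forall T (T0 : 0 < T)
    (mu : Mgamma n g), (forall f : Omega R n -> R, continuous f ->
      (charge_integral mu f =
       \int[uniform_average P T0]_p (f (Omega_process sigma w p))%:E)%E) ->
  (action L g mu <= C%:E)%E.
Proof.
have [C LC] := zero_section_bounded (on_Omega_continuous hL).
exists C => T T0 mu muE; rewrite /action muE; last exact: on_Omega_continuous.
apply: integral_uniform_average_le.
  by apply: Omega_process_comp_measurable; exact: on_Omega_continuous.
move=> p; rewrite (lagrangian_ge0 hL)/=.
exact: le_trans (ler_norm _) (LC _).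
Qed.

End zero_control_occupation.

(** * Extraction of a sequence of times *)

(** At stage [k] only finitely many conditions are imposed: [T > k] and closeness [1 / (k + 1)] for
    the first [k] quantities. Their intersection belongs to [U], hence is nonempty. This is where
    countability of the family matters. *)
Lemma ultrafilter_diagonal (R : realType) (U : set_system R)
    (b : nat -> R -> R) :
  UltraFilter U -> pinfty_nbhs R `<=` U -> (forall j T, `|b j T| <= 1) ->
  exists T_ : nat -> R, [/\ forall k, 0 < T_ k, T_ @ \oo --> +oo &
    forall j, (fun k => b j (T_ k)) @ \oo --> lim (b j @ U)].
Proof.
move=> UU Uoo b1; have FU := @ultra_proper _ _ UU.
have cb j : b j @ U --> lim (b j @ U).
  by apply: (ultrafilter_bounded_cvg (M := 1)); exact: nearW.
have near_b k N : \forall T \near U,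
    forall j, (j < N)%N -> `|lim (b j @ U) - b j T| < k.+1%:R^-1.
  elim: N => [|N ih]; first exact: nearW.
  have kN : \forall T \near U, `|lim (b N @ U) - b N T| < k.+1%:R^-1.
    by have /cvgrPdist_lt := cb N; apply; rewrite invr_gt0.
  apply: filterS2 ih kN => T ih' kN' j; rewrite ltnS leq_eqVlt.
  by move=> /predU1P[->//|]; exact: ih'.
have exT k : exists T : R, k%:R < T /\
    forall j, (j < k)%N -> `|lim (b j @ U) - b j T| < k.+1%:R^-1.
  have kT : \forall T \near U, k%:R < T.
    by apply: Uoo; exact: nbhs_pinfty_gt.
  exact: filter_ex (filterI kT (near_b k k)).
have [T_ T_P] := choice exT.
exists T_; split.
- by move=> k; have [+ _] := T_P k; exact: le_lt_trans.
- apply/cvgryPge => A; near=> k.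
  have [kT _] := T_P k; apply: le_trans (ltW kT).
  by near: k; exact: nbhs_infty_ger.
- move=> j; apply/cvgrPdist_lt => e e0; near=> k.
  have [_ /(_ j)] := T_P k.
  have jk : (j < k)%N by near: k; exact: nbhs_infty_gt.
  move=> /(_ jk) /lt_trans; apply.
  near: k; exact: near_infty_natSinv_lt (PosNum e0).
Unshelve. all: by end_near. Qed.

(** * Periodic functions and grids on the torus *)

Section cells.
Context (R : realType) (n : nat).
Implicit Types x y z : 'rV[R]_n.

(** Compactness of the unit cube gives one scale for all its points; a general pair is moved by the
    integer vector that brings [x] into the cube, which preserves both values and the difference of
    the points. *)
Lemma periodic_uniformly_continuous (f : 'rV[R]_n -> R) (e : R) :
  continuous f -> (forall x y, int_translate x y -> f x = f y) -> 0 < e ->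
  exists k : nat, forall x y, ball x k.+1%:R^-1 y -> `|f x - f y| <= e.
Proof.
move=> cf pf e0.
pose C := [set x : 'rV[R]_n | forall i, `[0, 1]%classic (x ord0 i)].
have cC : compact C.
  apply: (@rV_compact R n (fun=> `[0, 1]%classic)) => i.
  exact: segment_compact.
have [|N _ HN] := (compact_near_coveringP C).1 cC nat \oo
    (fun k x => forall y, ball x k.+1%:R^-1 y -> `|f x - f y| <= e).
  move=> x _.
  have e20 : 0 < e / 2 by rewrite divr_gt0.
  have := cf x => /cvgrPdist_lt /(_ _ e20) /nbhs_ballP[d d0 fd].
  have d20 : 0 < d / 2 by rewrite divr_gt0.
  exists (ball x (d / 2), [set k | k.+1%:R^-1 < d / 2]).
    split; first exact: nbhsx_ballx.
    exact: near_infty_natSinv_lt (PosNum d20).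
  move=> [z k] /= [xz kd] y zy.
  have fz : `|f x - f z| < e / 2.
    apply: fd; apply: le_ball xz.
    by rewrite ler_pdivrMr// mulr2n mulrDr mulr1 lerDl ltW.
  have fy : `|f x - f y| < e / 2.
    apply: fd; rewrite /= [d]splitr; apply: ball_triangle xz _.
    by apply: le_ball zy; exact: ltW.
  rewrite [e]splitr (le_trans (ler_distD (f x) _ _))// lerD//.
    by rewrite distrC ltW.
  exact: ltW.
exists N => x y xy.
have [z /to_torusP zx z01] := fractional_part x.
have kx u : f (u + (z - x)) = f u.
  apply: pf; apply/forallP => i.
  rewrite !mxE [_ + _ - _]addrC addrA addNr add0r.
  by have /forallP/(_ i) := zx.
have xz : x + (z - x) = z by rewrite addrC subrK.
rewrite -(kx x) -(kx y) xz; apply: (HN N) => //=.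
move: xy; rewrite -{1}xz; move: (z - x) => u.
by rewrite -!ball_normE /= opprD addrACA subrr addr0.
Qed.

End cells.

Section grid.
Context (R : realType) (n : nat).
Implicit Types x y : 'rV[R]_n.

(** Reduction modulo [k.+1] makes the cells periodic and finite in number for each [k]. The
    remainder is below [k.+1], so [inord] never takes its default value. *)
Definition residue k (m : int) : 'I_k.+1 := inord `|(m %% k.+1)%Z|%N.

Definition cell k x : {ffun 'I_n -> 'I_k.+1} :=
  [ffun i => residue k (Num.floor (x 0 i * k.+1%:R))].

(** In spite of the name, this is the lower corner of the cell inside the unit cube. *)
Definition center k (J : {ffun 'I_n -> 'I_k.+1}) : 'rV[R]_n :=
  \row_i ((J i)%:R / k.+1%:R).

Lemma residueE k m :
  m%:~R = (m %/ k.+1)%Z%:~R * k.+1%:R + (residue k m)%:R :> R.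
Proof.
have m0 : (0 <= (m %% k.+1)%Z)%R by rewrite modz_ge0.
rewrite inordK; last by rewrite -ltz_nat gez0_abs// ltz_pmod.
rewrite {1}(divz_eq m k.+1) intrD intrM; congr (_ + _).
by rewrite -[LHS]/((m %% k.+1)%Z%:~R) -{1}(gez0_abs m0).
Qed.

(** The grid point [y] just below [x] is within [1 / (k + 1)] of it, and by [residueE] it differs
    from [center (cell k x)] by an integer vector. *)
Lemma periodic_cell_approx (f : 'rV[R]_n -> R) (e : R) k :
  (forall x y, int_translate x y -> f x = f y) ->
  (forall x y, ball x k.+1%:R^-1 y -> `|f x - f y| <= e) ->
  forall x, `|f x - f (center (cell k x))| <= e.
Proof.
move=> pf fe x.
pose y : 'rV[R]_n := \row_i ((Num.floor (x 0 i * k.+1%:R))%:~R / k.+1%:R).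
rewrite -(pf y (center (cell k x))); last first.
  apply/forallP => i; rewrite !mxE ffunE (residueE k) mulrDl addrK.
  by rewrite mulfK ?intr_int// pnatr_eq0.
apply: fe; split => // j i; rewrite ord1 mxE.
by rewrite -ball_normE /=; exact: ltr_dist_floor.
Qed.

Lemma measurable_cell d (Z : measurableType d) (Y : Z -> 'rV[R]_n) k J :
  (forall i, measurable_fun setT (fun z => Y z 0 i)) ->
  measurable [set z | cell k (Y z) = J].
Proof.
move=> mY.
have -> : [set z | cell k (Y z) = J] = \bigcap_(i in [set: 'I_n])
    \bigcup_(m : int) (if residue k m == J i then
       [set z | Num.floor (Y z 0 i * k.+1%:R) = m] else set0).
  apply/seteqP; split => [z <- i _|z H].
    by exists (Num.floor (Y z 0 i * k.+1%:R)); rewrite // ffunE eqxx.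
  apply/ffunP => i; have [m _] := H i I.
  by rewrite ffunE; case: eqP => //= <- ->.
apply: fin_bigcap_measurable => // i _.
apply: countable_bigcupT_measurable => [|m]; first exact: countableP.
case: eqP => // _; rewrite -[X in measurable X]setTI.
exact: (mY i measurableT _ (measurable_floor_fiber k m)).
Qed.

End grid.

Section zero_control_sequence.
Context (R : realType) (n : nat) (sigma : R).
Context d (W : measurableType d) (P : probability W R).
Variables (F : R -> set_system W) (hF : filtration F).
Variables (w : R -> W -> 'rV[R]_n) (hw : brownian_motion P F w).

Definition cell_event k J : set (W * measurableTypeR R) :=
  [set p | cell k (lifted_process sigma w p) = J].

Lemma measurable_cell_event k J : measurable (@cell_event k J).
Proof. exact: measurable_cell (lifted_process_measurable sigma hF hw). Qed.

(** [f] is replaced by its value at the corner of each cell. The point is that [k] and [c] do not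
    depend on [T]: the time enters only through finitely many cell masses. *)
Lemma zero_control_average_approx (f : Omega R n -> R) (e : R) :
  continuous f -> 0 < e -> exists k (c : {ffun 'I_n -> 'I_k.+1} -> R),
  forall T (T0 : 0 < T),
    `|fine (\int[uniform_average P T0]_p (f (Omega_process sigma w p))%:E)%E -
      \sum_J c J * fine (uniform_average P T0 (cell_event J))| <= e.
Proof.
move=> cf e0.
pose h x := f (to_Omega (x, 0)).
have ch : continuous h.
  by move=> x; exact: (continuous_comp (@zero_section_continuous R n x) (cf _)).
have ph x y : int_translate x y -> h x = h y.
  by move=> /to_torusP xy; rewrite /h /to_Omega/= xy.
have [k hk] := periodic_uniformly_continuous ch ph e0.
have {}hk := periodic_cell_approx ph hk.
have [M hM] := zero_section_bounded cf.
pose c J := h (@center R n k J).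
exists k, c => T T0.
have mf : measurable_fun setT (fun p => f (Omega_process sigma w p)).
  exact: (Omega_process_comp_measurable sigma hF hw cf).
have cE p : c (cell k (lifted_process sigma w p)) =
    \sum_J c J * \1_(cell_event J) p.
  rewrite (bigD1 (cell k (lifted_process sigma w p)))//= indicE mem_set//.
  rewrite mulr1 big1 ?addr0// => J Jp; rewrite indicE memNset ?mulr0//.
  by move=> /esym/eqP; apply/negP.
have mA (J : {ffun 'I_n -> 'I_k.+1}) := measurable_cell_event J.
have mcA (J : {ffun 'I_n -> 'I_k.+1}) :
    measurable_fun setT (fun p => c J * \1_(cell_event J) p : R).
  by apply: measurable_funM => //; exact: measurable_indic.
have mA1 (J : {ffun 'I_n -> 'I_k.+1}) :
    measurable_fun setT (\1_(cell_event J) : W * measurableTypeR R -> R).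
  exact: measurable_indic.
have A_le (J : {ffun 'I_n -> 'I_k.+1}) p :
    `|\1_(cell_event J) p| <= 1 :> R.
  by rewrite indicE; case: (_ \in _); rewrite ?normr1 ?normr0.
have cA_le (J : {ffun 'I_n -> 'I_k.+1}) p : `|c J * \1_(cell_event J) p| <= M.
  by rewrite -[M]mulr1 normrM ler_pM//; exact: hM.
have sumE : (\int[uniform_average P T0]_p
    (c (cell k (lifted_process sigma w p)))%:E =
    (\sum_J c J * fine (uniform_average P T0 (cell_event J)))%:E)%E.
  under eq_integral do rewrite cE -sumEFin.
  rewrite integral_sum//; last first.
    move=> J.
    exact: (bounded_uniform_average_integrable P T0 (mcA J) (cA_le J)).
  rewrite -sumEFin; apply: eq_bigr => J _.
  under eq_integral do rewrite EFinM.
  rewrite integralZl//; last first.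
    exact: (bounded_uniform_average_integrable P T0 (mA1 J) (A_le J)).
  rewrite integral_indic// setIT EFinM fineK// ge0_fin_numE//.
  apply: (@le_lt_trans _ _ (uniform_average P T0 setT)).
    by rewrite le_measure ?inE.
  by rewrite [ltLHS]uniform_averageT ltry.
have <- : fine (\int[uniform_average P T0]_p
    (c (cell k (lifted_process sigma w p)))%:E)%E =
    \sum_J c J * fine (uniform_average P T0 (cell_event J)).
  by rewrite sumE.
apply: (uniform_average_dist_le P T0 mf
  (fun p => hM (lifted_process sigma w p))).
- by under eq_fun do rewrite cE; exact: measurable_sum.
- by move=> p; exact: hM.
- by move=> p; exact: hk.
Qed.

End zero_control_sequence.

(** * Existence of a minimizer *)

Lemma ptws_eval_continuous (I : Type) (T : topologicalType) (i : I) :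
  continuous (fun h : {ptws I -> T} => h i).
Proof.
move=> h A hA.
have /cvg_sup/(_ i) H : h --> (h : {ptws I -> T}) by exact: cvg_id.
apply: H; exact: (@initial_continuous _ _ (fun h : I -> T => h i) h A hA).
Qed.

Section nonempty.
Context (R : realType) (n : nat) (sigma : R).
Variables (L : 'rV[R]_n -> 'rV[R]_n -> R) (g : R -> R).
Hypotheses (hL : lagrangian L) (hg : admissible_weight L g).
Context d (W : measurableType d) (P : probability W R).
Variables (F : R -> set_system W) (hF : filtration F).
Variables (w : R -> W -> 'rV[R]_n) (hw : brownian_motion P F w).

Lemma pairing_continuous (phi : C0gamma n g) :
  continuous (fun nu : Mgamma n g => pairing nu phi).
Proof.
move=> nu.
have c1 : {for nu, continuous (@pairing R n g)} by exact: initial_continuous.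
have c2 : {for pairing nu,
    continuous (fun h : {ptws C0gamma n g -> R} => h phi)}.
  exact: ptws_eval_continuous.
exact: (continuous_comp c1 c2).
Qed.

(** [pickle] numbers all pairs of a mesh and a cell by one integer, as the diagonal extraction
    requires. The value is 0 at integers that encode no cell and at times [T <= 0], where the
    uniform law is undefined. *)
Let cell_average (j : nat) (T : R) : R :=
  if (unpickle j : option {k : nat & {ffun 'I_n -> 'I_k.+1}}) is
    Some (existT k J) then
    if pselect (0 < T) is left T0 then
      fine (uniform_average P T0 (cell_event sigma w J))
    else 0
  else 0.

Let cell_average_le1 j T : `|cell_average j T| <= 1.
Proof.
rewrite /cell_average; case: unpickle => [[k J]|]; last by rewrite normr0.
case: pselect => [T0|_]; last by rewrite normr0.
rewrite ger0_norm ?fine_ge0// -lee_fin.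
have mle : (uniform_average P T0 (cell_event sigma w J) <= 1)%E.
  rewrite -(uniform_averageT P T0) le_measure ?inE//.
  exact: (measurable_cell_event sigma hF hw J).
by rewrite fineK// ge0_fin_numE//; exact: le_lt_trans mle (ltry 1).
Qed.

Let cell_averageE k (J : {ffun 'I_n -> 'I_k.+1}) T (T0 : 0 < T) :
  cell_average (pickle (existT (fun k => {ffun 'I_n -> 'I_k.+1}) k J)) T =
  fine (uniform_average P T0 (cell_event sigma w J)).
Proof.
by rewrite /cell_average pickleK; case: pselect.
Qed.

(** The limit [mu] is found along the ultrafilter, the times [T_] are chosen to reproduce the limits
    of all cell masses, and each test function is compared with a finite combination of these
    masses. *)
Lemma M0_M1_nonempty : (M0 sigma P g F w `&` M1 n g) !=set0.
Proof.
have [C LC] := zero_control_action_bounded sigma g hL hF hw.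
have [nu nuP] : {nu : R -> Mgamma n g & forall T (T0 : 0 < T),
  [/\ M1 n g (nu T), occupation_measure sigma P w (fun _ _ => 0) 0 T (nu T)
    & forall f : Omega R n -> R, continuous f ->
      (charge_integral (nu T) f =
       \int[uniform_average P T0]_p (f (Omega_process sigma w p))%:E)%E]}.
  apply: (@choice _ _ (fun T mu => forall (T0 : 0 < T),
  [/\ M1 n g mu, occupation_measure sigma P w (fun _ _ => 0) 0 T mu
    & forall f : Omega R n -> R, continuous f ->
      (charge_integral mu f =
       \int[uniform_average P T0]_p (f (Omega_process sigma w p))%:E)%E])) => T.
  have [T0|T0] := pselect (0 < T).
    have [mu muP] := zero_control_occupation sigma hg hF hw T0.
    by exists mu => T0'; rewrite (Prop_irrelevance T0' T0).
  (* For [T <= 0] the requirement is vacuous and any element of [Mgamma] will do, here the one of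
     time 1. *)
  by have [mu _] := zero_control_occupation sigma hg hF hw ltr01; exists mu.
have [U [UU Uoo]] := ultraFilterLemma (@proper_pinfty_nbhs R).
have FU := @ultra_proper _ _ UU.
have U0 : \forall T \near U, 0 < T by apply: Uoo; exact: nbhs_pinfty_gt.
have [|mu [numu mu1 _]] := M1_sublevel_compact hL hg (nu := nu) (C := C) UU.
  by apply: filterS U0 => T T0; have [? _ /LC] := nuP T T0.
have [T_ [T_0 T_oo T_b]] := ultrafilter_diagonal UU Uoo cell_average_le1.
exists mu; split => //; apply: subset_closure.
exists (fun _ _ => 0), 0; split; first exact: zero_control_bounded.
exists T_, (nu \o T_); split => //.
  by move=> k; have [] := nuP (T_ k) (T_0 k).
apply: weak_star_cvg => phi.
suff : (fun k => pairing (nu (T_ k)) phi) @ \oo --> pairing mu phi by [].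
have [cphi _ _] := C0gammaP phi.
apply/cvgrPdist_le => e e0.
have e3 : 0 < e / 3 by rewrite divr_gt0.
have [k [c ck]] := zero_control_average_approx sigma hF hw cphi e3.
pose code (J : {ffun 'I_n -> 'I_k.+1}) :=
  pickle (existT (fun k => {ffun 'I_n -> 'I_k.+1}) k J).
pose S T := \sum_J c J * cell_average (code J) T.
(* [S] tends to [S0] both along [U] and along [T_]; this common limit links the sequence to [mu]. *)
pose S0 := \sum_J c J * lim (cell_average (code J) @ U).
have phiS T : 0 < T -> `|pairing (nu T) phi - S T| <= e / 3.
  move=> T0; have [_ _ /(_ _ cphi) nuE] := nuP T T0.
  rewrite /pairing nuE /S.
  under [X in _ - X]eq_bigr do rewrite (cell_averageE _ T0).
  exact: ck.
have SU : S @ U --> S0.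
  apply: cvgr_sum => J; apply: cvgM; first exact: cvg_cst.
  by apply: (ultrafilter_bounded_cvg (M := 1)); exact: nearW.
have ST : (fun j => S (T_ j)) @ \oo --> S0.
  by apply: cvgr_sum => J; apply: cvgM; [exact: cvg_cst|exact: T_b].
have phiU : (fun T => pairing (nu T) phi) @ U --> pairing mu phi.
  exact: (cvg_comp _ _ numu (@pairing_continuous phi mu)).
(* The bound [phiS] is uniform in [T > 0], so it passes to the limit along [U]. *)
have h1 : `|pairing mu phi - S0| <= e / 3.
  apply: (cvgr_to_le (cvg_norm (cvgB phiU SU))).
  by apply: filterS U0 => T; exact: phiS.
near=> j.
have h3 : `|S0 - S (T_ j)| <= e / 3.
  by near: j; move/cvgrPdist_le: ST; apply.
apply: le_trans (distr_le3 h1 (phiS _ (T_0 j)) h3) _.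
by rewrite third_add.
Unshelve. all: by end_near. Qed.

End nonempty.

Theorem theorem1 (R : realType) (n : nat) (sigma : R) (hsigma : 0 <= sigma)
    (L : 'rV[R]_n -> 'rV[R]_n -> R) (hL : lagrangian L)
    (g : R -> R) (hg : admissible_weight L g)
    (d : measure_display) (W : measurableType d) (P : probability W R)
    (F : R -> set_system W) (hF : filtration F)
    (w : R -> W -> 'rV[R]_n) (hw : brownian_motion P F w) :
  exists mu : Mgamma n g,
    (M0 sigma P g F w `&` M1 n g) mu /\
    action L g mu =
    ereal_inf [set action L g nu | nu in M0 sigma P g F w `&` M1 n g].
Proof.
set D := M0 _ _ _ _ _ `&` _; set l := ereal_inf _.
have [mu0 Dmu0] := M0_M1_nonempty sigma hL hg hF hw.
have l_le nu : D nu -> (l <= action L g nu)%E.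
  by move=> Dnu; apply: ereal_inf_lbound; exists nu.
have l0 : (0 <= l)%E.
  by apply: le_ereal_inf_tmp => _ [nu [_ nu1] <-]; exact: action_ge0.
(* If the infimum is infinite, every admissible measure attains it; otherwise real approximations
   [fine l + 1 / (k + 1)] are available. *)
have [loo|lfin] := eqVneq l +oo%E.
  exists mu0; split => //; apply/eqP; rewrite eq_le l_le// andbT loo.
  exact: leey.
have {}lfin : l \is a fin_num by rewrite ge0_fin_numE// ltey.
have [nu nuP] : {nu : nat -> Mgamma n g & forall k,
    D (nu k) /\ (action L g (nu k) <= (fine l + k.+1%:R^-1)%:E)%E}.
  apply: (@choice _ _ (fun k nu => D nu /\
    (action L g nu <= (fine l + k.+1%:R^-1)%:E)%E)) => k.
  have k0 : 0 < k.+1%:R^-1 :> R by rewrite invr_gt0.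
  have [_ [nu Dnu <-] /ltW nul] := lb_ereal_inf_adherent k0 lfin.
  by exists nu; split => //; rewrite EFinD fineK.
have [U [UU Uoo]] := ultraFilterLemma (@eventually_filter).
have FU := @ultra_proper _ _ UU.
have nuB (e : R) : 0 < e ->
    \forall k \near U, (action L g (nu k) <= (fine l + e)%:E)%E.
  move=> e0; apply: Uoo.
  near=> k; have [_ /le_trans] := nuP k; apply.
  rewrite lee_fin lerD2l ltW//.
  by near: k; exact: near_infty_natSinv_lt (PosNum e0).
have [|mu [numu mu1 muB]] :=
    M1_sublevel_compact hL hg (nu := nu) (C := fine l + 1) UU.
  by apply: filterS (nuB 1 ltr01) => k ?; have [[]] := nuP k.
(* [M0] is a closure, so it contains the limit along the ultrafilter although no subsequence is
   extracted. *)
have Dmu : D mu.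
  split => //; apply: (closed_cvg _ (@closed_closure _ _) _ _ numu).
  by apply: nearW => k; have [[]] := nuP k.
exists mu; split => //; apply/eqP; rewrite eq_le l_le// andbT.
apply/lee_addgt0Pr => e e0; rewrite -(fineK lfin) -EFinD.
exact/muB/nuB.
Unshelve. all: by end_near. Qed.
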